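(* There is an algorithm with running time $O(d)$ which, given $A\in\{0,\ast\}^{d\times d}$ whose digraph $G(A)$ is a directed tree towards some vertex $x\in\mathcal{A}$ with a self-loop at every state vertex, a set $F\subset\mathcal{A}$ and an integer $\ell\in[d]$ with $\mu(A,I_F)\le\ell$, computes an optimal solution of the problem $$\min_{J\subset F}\ |J|\quad\text{subject to}\quad \mu(A,I_J)\le\ell .$$
   Context: Notation: $[d]=\{1,\dots,d\}$. A sparsity matrix is a matrix with entries in $\{0,\ast\}$, where $0$ is a fixed zero and each $\ast$ is an independent free real parameter. For a sparsity matrix $H$, $[H]$ is the set of all real matrices of the same size obtained by giving numerical values to the $\ast$ entries (entries $0$ stay zero). For $A\in\{0,\ast\}^{d\times d}$, the digraph $G(A)=(\mathcal{A},E_A)$ has state vertices $\mathcal{A}=\{x_1,\dots,x_d\}$ and edges $E_A=\{(x_j,x_i): A_{ij}\ne 0\}$. A digraph is a directed tree towards $x$ if it is acyclic, every vertex has a directed path to $x$, and every vertex except $x$ has out-degree exactly $1$; ''a directed tree with a self-loop at every vertex'' means that the digraph obtained by discarding the self-loops is a directed tree and that every vertex carries a self-loop. For $J\subset\mathcal{A}$, $I_J\in\{0,\ast\}^{|J|\times d}$ is obtained from the $d\times d$ sparsity matrix $I_d$ (with $\ast$ on the diagonal and $0$ elsewhere) by retaining the rows corresponding to the state vertices in $J$. For real matrices $\bar A\in\mathbb{R}^{d\times d}$, $\bar C\in\mathbb{R}^{p\times d}$, let $O_k(\bar A,\bar C)=\begin{pmatrix}\bar C^\top & (\bar C\bar A)^\top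 & \cdots & (\bar C\bar A^{k-1})^\top\end{pmatrix}^\top$. The structural observability index of a pair of sparsity matrices $(A,C)$ is $$\mu(A,C)=\inf\Big\{k\in[d]\ \Big|\ \sup_{A_1\in[A],\,C_1\in[C]}\operatorname{rank} O_k(A_1,C_1)=d\Big\},\qquad \inf\emptyset=+\infty .$$ The running time is measured with the directed tree $G(A)$ given as input. *)

(* Defs.v *)
From mathcomp Require Import all_boot all_order all_algebra.
From mathcomp Require Import boolp classical_sets reals constructive_ereal ereal.

Set Implicit Arguments.
Unset Strict Implicit.
Unset Printing Implicit Defensive.

Import Order.TTheory GRing.Theory Num.Theory.
Local Open Scope ring_scope.

(* A sparsity matrix is a boolean matrix: [true] stands for a free entry,
   [false] for a fixed zero.  State vertices x_1, ..., x_d are the elements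
   of 'I_d. *)

Definition realizations (R : realType) (m n : nat) (H : 'M[bool]_(m, n)) :
    set 'M[R]_(m, n) :=
  [set M | forall i j, ~~ H i j -> M i j = 0]%classic.

Definition obs_mx (R : realType) (d p k : nat) (A : 'M[R]_d) (C : 'M[R]_(p, d)) :
    'M[R]_(\sum_(i < k) p, d) :=
  \mxcol_(i < k) (C *m A ^+ i).

Definition generic_obs_rank (R : realType) (d p k : nat)
    (A : 'M[bool]_d) (C : 'M[bool]_(p, d)) : \bar R :=
  ereal_sup [set (\rank (obs_mx k A1 C1))%:R%:E
            | A1 in @realizations R d d A & C1 in @realizations R p d C]%classic.

(* Extended-real valued: [ereal_inf] of the empty set is +oo. *)
Definition obs_index (R : realType) (d p : nat)
    (A : 'M[bool]_d) (C : 'M[bool]_(p, d)) : \bar R :=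
  ereal_inf [set k%:R%:E | k in
    [set k : nat | (1 <= k <= d)%N
                   /\ generic_obs_rank R k A C = d%:R%:E]]%classic.

Definition sensor_mx (d : nat) (J : {set 'I_d}) : 'M[bool]_(#|J|, d) :=
  rowsub (fun i : 'I_#|J| => enum_val i) (\matrix_(i, j) (i == j)).

(* [digraph A j i] is the edge (x_j, x_i): note the transposition. *)
Definition digraph (d : nat) (A : 'M[bool]_d) : rel 'I_d := fun j i => A i j.

Definition acyclic (T : finType) (e : rel T) : Prop :=
  forall c : seq T, cycle e c -> c = [::].

Definition directed_tree_towards (T : finType) (e : rel T) (x : T) : Prop :=
  [/\ acyclic e,
      forall y, connect e y x
    & forall y, y != x -> #|[set z | e y z]| = 1%N].

Definition self_looped_tree_towards (T : finType) (e : rel T) (x : T) : Prop :=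
  directed_tree_towards [rel y z | e y z && (y != z)] x /\ forall y, e y y.

Definition feasible (R : realType) (d : nat) (A : 'M[bool]_d) (l : nat)
    (J : {set 'I_d}) : Prop :=
  (obs_index R A (sensor_mx J) <= l%:R%:E)%E.

Definition optimal_solution (R : realType) (d : nat) (A : 'M[bool]_d)
    (F : {set 'I_d}) (l : nat) (J : {set 'I_d}) : Prop :=
  [/\ J \subset F, feasible R A l J
    & forall J' : {set 'I_d}, J' \subset F -> feasible R A l J' ->
        (#|J| <= #|J'|)%N].

(* Model of computation: structured programs for a random access machine with
   finitely many registers and arrays of natural numbers (a program mentions
   only finitely many names), where constants, register reads, array reads,
   additions, truncated subtractions, writes and branchings take one time unit
   each.  A test succeeds when its value is nonzero. *)

Inductive expr : Type :=
| Const of nat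
| Reg of nat
| Read of nat & expr
| Add of expr & expr
| Sub of expr & expr.

Inductive prog : Type :=
| Skip
| Assign of nat & expr
| Write of nat & expr & expr
| Seq of prog & prog
| If of expr & prog & prog
| While of expr & prog.

Record state : Type := State { regs : nat -> nat; arrs : nat -> nat -> nat }.

Definition upd (T : Type) (f : nat -> T) (x : nat) (v : T) : nat -> T :=
  fun y => if y == x then v else f y.

Definition set_reg (s : state) (x v : nat) : state :=
  State (upd (regs s) x v) (arrs s).

Definition set_cell (s : state) (a i v : nat) : state :=
  State (regs s) (upd (arrs s) a (upd (arrs s a) i v)).

Fixpoint eval (s : state) (e : expr) : nat :=
  match e with
  | Const n => n
  | Reg x => regs s x
  | Read a e1 => arrs s a (eval s e1)
  | Add e1 e2 => eval s e1 + eval s e2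
  | Sub e1 e2 => eval s e1 - eval s e2
  end%N.

Fixpoint cost (e : expr) : nat :=
  match e with
  | Const _ | Reg _ => 1
  | Read _ e1 => (cost e1).+1
  | Add e1 e2 | Sub e1 e2 => (cost e1 + cost e2).+1
  end%N.

(* [exec w c s s' t]: run from [s], [c] halts in [s'] after [t] time units.
   The machine has words bounded by [w]: a run that would store a value above
   [w], or write at an address above [w], is stuck.  This keeps the unit cost
   of arithmetic honest; the intermediate values of an expression exceed [w]
   by a factor that depends on the program only. *)
Inductive exec (w : nat) : prog -> state -> state -> nat -> Prop :=
| ExecSkip s : exec w Skip s s 1
| ExecAssign s x e :
    (eval s e <= w)%N ->
    exec w (Assign x e) s (set_reg s x (eval s e)) (cost e).+1
| ExecWrite s a e1 e2 :
    (eval s e1 <= w)%N -> (eval s e2 <= w)%N ->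
    exec w (Write a e1 e2) s (set_cell s a (eval s e1) (eval s e2))
         (cost e1 + cost e2).+1
| ExecSeq c1 c2 s1 s2 s3 t1 t2 :
    exec w c1 s1 s2 t1 -> exec w c2 s2 s3 t2 ->
    exec w (Seq c1 c2) s1 s3 (t1 + t2)
| ExecIfTrue e c1 c2 s s' t :
    eval s e != 0%N -> exec w c1 s s' t ->
    exec w (If e c1 c2) s s' (cost e + t).+1
| ExecIfFalse e c1 c2 s s' t :
    eval s e == 0%N -> exec w c2 s s' t ->
    exec w (If e c1 c2) s s' (cost e + t).+1
| ExecWhileTrue e c s1 s2 s3 t1 t2 :
    eval s1 e != 0%N -> exec w c s1 s2 t1 -> exec w (While e c) s2 s3 t2 ->
    exec w (While e c) s1 s3 (cost e + t1 + t2).+1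
| ExecWhileFalse e c s :
    eval s e == 0%N -> exec w (While e c) s s (cost e).+1.

(* Programs are deterministic, so that exhibiting one terminating run
   describes the whole behaviour. *)
Lemma exec_det (w : nat) (c : prog) (s s1 s2 : state) (t1 t2 : nat) :
  exec w c s s1 t1 -> exec w c s s2 t2 -> s1 = s2 /\ t1 = t2.
Proof.
move=> H; elim: H s2 t2 => {c s s1 t1} [s|s x e _|s a e1 e2 _ _
  |c1 c2 s1 s2 s3 t1 t2 _ IH1 _ IH2|e c1 c2 s s' t He _ IH|e c1 c2 s s' t He _ IH
  |e c s1 s2 s3 t1 t2 He _ IH1 _ IH2|e c s He] s4 t4 H; inversion H; subst => //;
  repeat match goal with
  | IH : forall s t, exec w ?c ?s0 s t -> _, H : exec w ?c ?s0 _ _ |- _ =>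
      case: (IH _ _ H) => ? ?; subst; clear IH
  end => //;
  by match goal with
  | H1 : is_true (?x == ?y), H2 : is_true (?x != ?y) |- _ => rewrite H1 in H2
  end.
Qed.

(* A digraph on 'I_d is given to the machine by d and a list of its edges. *)
Definition edge_list (d : nat) (e : rel 'I_d) (es : seq ('I_d * 'I_d)) : Prop :=
  uniq es /\ forall u v, ((u, v) \in es) = e u v.

(* Registers 0, 1, 2 hold d, l and the number of edges; arrays 0 and 1 hold the
   tails and the heads of the edges, array 2 the indicator of F.  All other
   registers and cells are zero. *)
Definition input (d : nat) (es : seq ('I_d * 'I_d)) (F : {set 'I_d}) (l : nat) :
    state :=
  State (nth 0%N [:: d; l; size es])
        (fun a => nth 0%N (nth [::] [:: [seq val e.1 | e <- es];
                                        [seq val e.2 | e <- es];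
                                        [seq nat_of_bool (v \in F) | v <- enum 'I_d]] a)).

(* The answer is read off array 3, as an indicator. *)
Definition output (d : nat) (s : state) : {set 'I_d} :=
  [set v : 'I_d | arrs s 3 v != 0%N].

(* Main.v *)
From mathcomp Require Import all_boot all_order all_algebra.
From mathcomp Require Import boolp classical_sets reals constructive_ereal ereal.
From mathcomp Require Import fintype finset zify.
Require Import Defs.

Set Implicit Arguments.
Unset Strict Implicit.
Unset Printing Implicit Defensive.

Import Order.TTheory GRing.Theory Num.Theory.

(** Write the self-looped tree as a parent function p with root x.  For a set J
    of sensors containing x, the region of j in J consists of the states whose
    nearest sensor on the way to the root is j.

    Feasibility is a size condition: mu(A, I_J) <= l exactly when x is in J and
    every region has at most l states ([feasibleP]).  If the observability
    matrix O_k has rank d, its columns in the region of j are independent, and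
    yet they have rank at most k: the states of the region influence the others
    only through j, so on these columns every row of C A^m, m < k, is a
    combination of the k rows e_j B^t (t < k) of the compression B of A to the
    region ([region_le]).  Conversely, delete the edges
    that leave a sensor, put 1 on the other edges and distinct numbers that
    grow away from the root on the diagonal.  In a region of n states the
    polynomials e_j (A - a_1) ... (A - a_i), i < n, where a_1 < a_2 < ... are the
    diagonal entries of the region, then form a triangular system
    ([annihilator_support], [cut_mx_observable]).

    So the problem is to cut a tree into as few connected pieces of size at
    most l as possible, where only the edges that leave a vertex of F may be
    cut.  Hang every vertex v directly under the nearest vertex of F that is
    strictly above v ([sensor_parent]); the vertices outside F become leaves
    that may not be cut.  Going up the tree, cut at each vertex the largest
    available children until the rest fits into l.  By induction on the tree,
    the greedy solution makes below each vertex at most as many cuts as any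
    feasible solution, and leaves at most as large a residual piece when the
    numbers agree ([greedy_le]): a competitor that spends an additional cut
    below a child gains at most what cutting that child gains.

    For linear time, the largest children are found by a bucket sort, only at
    vertices where the size exceeds l.  Its cost is the number of children plus
    the largest child size M; as a child of size M is then cut, and cut pieces
    are disjoint, the sum of all M is at most d ([sum_cut_residuals],
    [spent_bound]).  A leaves-first order of the vertices and their nearest
    candidates are computed beforehand by peeling leaves off with a queue. *)

(** * Rooted trees as parent functions *)

Section RootedTree.
Variables (T : finType) (x : T) (p : T -> T) (h : T -> nat).
Hypothesis h_p : forall v, v != x -> h (p v) < h v.

(** Induction from the root: [h] decreases along [p]. *)
Lemma root_ind (P : T -> Prop) :
  (forall v, (v != x -> P (p v)) -> P v) -> forall v, P v.
Proof.
move=> IH v; elim: {v}(h v) {-2}v (leqnn (h v)) => [|n IHn] v hv;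
  apply: IH => /h_p hp; first by lia.
by apply: IHn; lia.
Qed.

(** Induction from the leaves, on how far [h] is from its maximum. *)
Lemma leaf_ind (P : T -> Prop) :
  (forall v, (forall c, c != x -> p c = v -> P c) -> P v) -> forall v, P v.
Proof.
move=> IH; have h_le v : h v <= \max_v h v by apply: leq_bigmax.
suff H n v : \max_v h v - h v <= n -> P v by move=> v; apply: H (leqnn _).
elim: n v => [|n IHn] v hv; apply: IH => c /h_p hp pc; have := h_le c.
  by rewrite pc in hp; lia.
by move=> ?; apply: IHn; rewrite pc in hp; lia.
Qed.

(** The first vertex of [J] among [v], [p v], [p (p v)], and so on, searched with
    fuel [n]; the rank [h v] bounds the number of steps to the root. *)
Fixpoint climb (J : {set T}) (n : nat) (v : T) : T :=
  if n is n'.+1 then if v \in J then v else climb J n' (p v) else v.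

Definition nearest (J : {set T}) (v : T) : T := climb J (h v).+1 v.

Lemma climb_stable (J : {set T}) n m v :
  x \in J -> h v < n -> h v < m -> climb J n v = climb J m v.
Proof.
move=> xJ; elim: n m v => [|n IH] [|m] v //= hn hm.
case: ifP => // /negbT vJ; have/h_p hp: v != x by apply: contraNneq vJ => ->.
by apply: IH; lia.
Qed.

Lemma nearestE (J : {set T}) v : x \in J ->
  nearest J v = if v \in J then v else nearest J (p v).
Proof.
move=> xJ; rewrite /nearest [LHS]/=; case: ifP => // /negbT vJ.
have/h_p hp: v != x by apply: contraNneq vJ => ->.
by apply: climb_stable.
Qed.

Lemma nearest_id (J : {set T}) v : x \in J -> v \in J -> nearest J v = v.
Proof. by move=> xJ vJ; rewrite nearestE // vJ. Qed.

Lemma nearest_in (J : {set T}) v : x \in J -> nearest J v \in J.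
Proof.
move=> xJ; elim/root_ind: v => v IH; rewrite nearestE //.
case: ifP => // /negbT vJ; apply: IH.
by apply: contraNneq vJ => ->.
Qed.

(** A walk to the root that looks for [J] passes the nearest vertex of any
    larger set first. *)
Lemma nearest_sub (J F : {set T}) v : x \in J -> J \subset F ->
  nearest J (nearest F v) = nearest J v.
Proof.
move=> xJ JF; have xF := subsetP JF _ xJ.
elim/root_ind: v => v IH; rewrite (nearestE v xF); case: ifP => // /negbT vF.
rewrite IH; last by apply: contraNneq vF => ->.
by rewrite [in RHS]nearestE // ifN //; apply: contraNN vF; apply: subsetP.
Qed.

Lemma h_nearest (J : {set T}) v : x \in J -> h (nearest J v) <= h v.
Proof.
move=> xJ; elim/root_ind: v => v IH; rewrite nearestE //.
case: ifP => // /negbT vJ; have vx: v != x by apply: contraNneq vJ => ->.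
by have := IH vx; have := h_p vx; lia.
Qed.

(** The root may have any value under [p], so it is excluded explicitly. *)
Definition child (v c : T) : bool := (c != x) && (p c == v).

(** Recursion from the leaves, as the existence of a solution of its equations;
    [keep] selects the children that contribute. *)
Lemma leaf_rec (w : T -> nat) (keep : pred T) :
  exists r, forall v, r v = w v + \sum_(c | child v c && keep c) r c.
Proof.
pose fix rr n v {struct n} :=
  w v + if n is n'.+1 then \sum_(c | child v c && keep c) rr n' c else 0.
pose H := \max_v h v; have hH v : h v <= H by apply: leq_bigmax.
have st n m v : H <= n + h v -> H <= m + h v -> rr n v = rr m v.
  elim: n m v => [|n IH] [|m] v //= Hn Hm; congr (_ + _).
  - rewrite big_pred0 // => c; apply/negP => /andP[/andP[/h_p hc /eqP cv] _].
    by have := hH c; rewrite cv in hc; lia.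
  - rewrite big_pred0 // => c; apply/negP => /andP[/andP[/h_p hc /eqP cv] _].
    by have := hH c; rewrite cv in hc; lia.
  - apply: eq_bigr => c /andP[/andP[/h_p hc /eqP cv] _].
    by rewrite cv in hc; apply: IH; lia.
exists (rr H.+1) => v; rewrite [LHS]/=; congr (_ + _); apply: eq_bigr => c _.
by apply: st; lia.
Qed.

(** A vertex other than the root is the child of exactly one vertex. *)
Lemma sum_children (f : T -> nat) (keep P : pred T) :
  \sum_(v | P v) \sum_(c | child v c && keep c) f c =
  \sum_(c | (c != x) && P (p c) && keep c) f c.
Proof.
rewrite (exchange_big_dep (fun c => (c != x) && P (p c) && keep c)) /=; last first.
  by move=> v c Pv /andP[/andP[-> /eqP->] ->]; rewrite Pv.
apply: eq_bigr => c /andP[/andP[cx Pc] kc].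
rewrite (big_pred1 (p c)) // => v; rewrite /child cx kc /= andbT eq_sym.
by case: eqP => [->|]; rewrite ?andbF ?Pc.
Qed.

End RootedTree.

(** * Observability within l steps means small regions *)

Local Open Scope ring_scope.

(** The root has no outgoing edge, since that edge would close a cycle; the
    rank of a vertex is the number of vertices that it reaches. *)
Lemma tree_parent (d : nat) (A : 'M[bool]_d) (x : 'I_d) :
  self_looped_tree_towards (digraph A) x ->
  exists (p : 'I_d -> 'I_d) (h : 'I_d -> nat),
    (forall v, v != x -> (h (p v) < h v)%N) /\
    (forall u v, A v u = (v == u) || ((u != x) && (v == p u))).
Proof.
case=> [[acyc conn deg] loop].
set e := [rel y z | digraph A y z && (y != z)] in acyc conn deg.
have e_acyc y z : e y z -> ~~ connect e z y.
  move=> yz; apply/negP => /connectP[s zs ey].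
  by have /acyc: cycle e (z :: s) by rewrite /= rcons_path zs -ey.
have e_root z : ~~ e x z.
  by apply/negP => xz; have := e_acyc _ _ xz; rewrite conn.
pose p v := odflt v [pick z | e v z].
have e_p v z : e v z = (v != x) && (z == p v).
  case: (eqVneq v x) => [->|vx]; first by apply/negbTE/e_root.
  rewrite [RHS]/=.
  have /eqP/cards1P[w ew] := deg v vx.
  have eE y : e v y = (y == w) by have := in_set1 y w; rewrite -ew inE.
  rewrite /p eE; case: pickP => [y|/(_ w)]; last by rewrite eE eqxx.
  by rewrite eE => /eqP->.
exists p, (fun v => #|connect e v|); split=> [v vx|u v].
  have vp : e v (p v) by rewrite e_p vx eqxx.
  apply/proper_card/properP; split.
    by apply/subsetP => y; apply: connect_trans; apply: connect1.
  exists v; first exact: connect0.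
  exact: e_acyc.
case: (eqVneq v u) => [->|vu] /=; first exact: loop.
by have := e_p u v; rewrite /e /= eq_sym vu andbT.
Qed.

(** The ranks are integers at most [d], so the supremum is [d] only if it is
    attained; likewise an infimum of integers is at most [l] only if one of
    them is. *)
Lemma feasible_rank (R : realType) (d : nat) (A : 'M[bool]_d) (l : nat)
    (J : {set 'I_d}) : (l <= d)%N ->
  feasible R A l J <->
  exists (k : nat) (A1 : 'M[R]_d) (C1 : 'M[R]_(#|J|, d)),
    [/\ (0 < k <= l)%N, realizations A A1, realizations (sensor_mx J) C1
      & \rank (obs_mx k A1 C1) = d].
Proof.
move=> ld; rewrite /feasible /obs_index; split; last first.
  case=> k [A1 [C1 [/andP[k0 kl] A1P C1P rk]]].
  apply: (@le_trans _ _ k%:R%:E); last by rewrite lee_fin ler_nat.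
  apply: ereal_inf_lbound; exists k => //=; rewrite k0 (leq_trans kl ld); split=> //.
  apply/eqP; rewrite eq_le; apply/andP; split.
    apply: ge_ereal_sup => _ [M _ [N _ <-]].
    by rewrite lee_fin ler_nat rank_leq_col.
  by apply: ereal_sup_ubound; exists A1 => //; exists C1 => //; rewrite rk.
move=> le; have [k [/andP[k0 kd] gk] kl] : exists2 k : nat,
    (0 < k <= d)%N /\ generic_obs_rank R k A (sensor_mx J) = d%:R%:E & (k <= l)%N.
  apply: contrapT => no.
  suff: (l.+1%:R%:E <= (l%:R%:E : \bar R))%E by rewrite lee_fin ler_nat ltnn.
  apply: le_trans le; apply: le_ereal_inf_tmp => _ [k kP <-].
  rewrite lee_fin ler_nat ltnNge; apply/negP => kl.
  by apply: no; exists k.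
apply: contrapT => no.
suff: (generic_obs_rank R k A (sensor_mx J) <= d.-1%:R%:E)%E.
  by rewrite gk lee_fin ler_nat; lia.
apply: ge_ereal_sup => _ [M MA [N NJ <-]]; rewrite lee_fin ler_nat.
have := rank_leq_col (obs_mx k M N); rewrite leq_eqVlt => /predU1P[e|]; last by lia.
by case: no; exists k, M, N; rewrite k0 kl.
Qed.

Section TreeObservability.
Variables (R : realType) (d : nat) (A : 'M[bool]_d).
Variables (x : 'I_d) (p : 'I_d -> 'I_d) (h : 'I_d -> nat).
Hypothesis h_p : forall v, v != x -> (h (p v) < h v)%N.
Hypothesis A_p : forall u v, A v u = (v == u) || ((u != x) && (v == p u)).
Variable J : {set 'I_d}.
Local Notation near := (nearest p h J).

Lemma p_neq v : v != x -> p v != v.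
Proof. by move=> /h_p hv; apply/eqP => e; rewrite e ltnn in hv. Qed.

Section Necessity.
Variables (k : nat) (A1 : 'M[R]_d) (C1 : 'M[R]_(#|J|, d)).
Hypothesis A1P : realizations A A1.
Hypothesis C1P : realizations (sensor_mx J) C1.
Hypothesis full : row_full (obs_mx k A1 C1).

(** The basis vector of the root is an eigenvector of [A1], as no edge leaves the
    root; no sensor other than the root sees it. *)
Lemma root_sensor : x \in J.
Proof.
apply: contraT => xJ; pose e : 'cV[R]_d := delta_mx x 0.
have Ae : A1 *m e = A1 x x *: e.
  apply/colP => u; rewrite -colE !mxE eqxx andbT; case: eqP => [->|/eqP ux].
    by rewrite mulr1.
  by rewrite mulr0 A1P // A_p eqxx (negbTE ux).
have Ce : C1 *m e = 0.
  apply/colP => i; rewrite -colE !mxE C1P // !mxE.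
  by apply: contraNneq xJ => <-; apply: enum_valP.
have CAe i : C1 *m A1 ^+ i *m e = 0.
  elim: i => [|i IH]; first by rewrite expr0 mulmx1.
  by rewrite exprSr -mulmxE -!mulmxA Ae -!scalemxAr mulmxA IH scaler0.
have Oe : obs_mx k A1 C1 *m e = 0.
  by rewrite mxcol_mul -[RHS]mxcol0; apply: eq_mxcol => i; apply: CAe.
have : e x 0 = 0.
  by rewrite -[e]mul1mx -(mulVpmx full) -mulmxA Oe mulmx0 mxE.
by rewrite mxE !eqxx => /eqP; rewrite oner_eq0.
Qed.

(** The columns of the observability matrix in a region have rank at most [k],
    but also full rank. *)
Lemma region_le j : j \in J -> (#|[set v | near v == j]| <= k)%N.
Proof.
move=> jJ; set S := [set v | _]; have xJ := root_sensor.
have jS : j \in S by rewrite inE (nearest_id h_p).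
pose P : 'M[R]_d := diag_mx (\row_v (v \in S)%:R).
pose e : 'rV[R]_d := delta_mx 0 j.
pose a : 'cV[R]_d := \col_u ((u \notin S)%:R * A1 u j).
(* P projects to the region S of j.  An edge that leaves a state of S other
   than j ends in S, so the part of A1 P outside S lives in column j. *)
have AP : A1 *m P = P *m A1 *m P + a *m e.
  apply/matrixP => u v; rewrite -mulmxA mul_diag_mx mul_mx_diag !mxE big_ord1 !mxE.
  case: (boolP (v \in S)) => vS; last first.
    have -> : (v == j) = false by apply: contraNF vS => /eqP->.
    by rewrite andbF !mulr0 addr0.
  case: (boolP (u \in S)) => uS /=.
    by rewrite !mul0r addr0 mul1r.
  rewrite mul0r add0r mul1r; case: (eqVneq v j) => [->|vj] /=; first by [].
  rewrite mulr0 mulr1 A1P // A_p.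
  have vJ: v \notin J.
    by apply: contra vj => vJ; move: vS; rewrite inE (nearest_id h_p).
  rewrite negb_or negb_and; apply/andP; split.
    by apply: contraNneq uS => ->.
  apply/orP; right; apply: contraNneq uS => ->.
  by move: vS; rewrite !inE (nearestE h_p) // (negbTE vJ).
(* G m is the span of the first m rows e (A1 P)^t, hence of rank at most m. *)
pose fix G m : 'M[R]_d := if m is m'.+1 then (G m' *m (A1 *m P) + e)%MS else 0.
have rkG m : (\rank (G m) <= m)%N.
  elim: m => [|m IH] /=; first by rewrite mxrank0.
  apply: leq_trans (mxrank_adds_leqif _ _) _; rewrite -[m.+1]addn1; apply: leq_add.
    exact: leq_trans (mxrankM_maxl _ _) IH.
  exact: rank_leq_row.
have GS m : (G m <= G m.+1)%MS.
  by elim: m => [|m IH]; rewrite ?sub0mx //; apply: addsmxS => //; apply: submxMr.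
have G_mono m n : (m <= n)%N -> (G m <= G n)%MS.
  elim: n => [|n IH]; first by rewrite leqn0 => /eqP->.
  by rewrite leq_eqVlt => /predU1P[->//|/IH H]; apply: submx_trans H (GS n).
have CP : (C1 *m P <= e)%MS.
  suff -> : C1 *m P = col j C1 *m e by apply: submxMl.
  apply/matrixP => i v; rewrite mul_mx_diag !mxE big_ord1 !mxE.
  case: (eqVneq v j) => [->|vj]; first by rewrite jS.
  rewrite mulr0; case: (boolP (v \in S)) => vS; last by rewrite mulr0.
  rewrite C1P ?mul0r // !mxE; apply: contraNneq vj => iv; move: vS.
  by rewrite inE (nearest_id h_p) // -iv enum_valP.
have CAP m : (C1 *m A1 ^+ m *m P <= G m.+1)%MS.
  elim: m => [|m IH].
    by rewrite expr0 mulmx1; apply: submx_trans CP _; apply: addsmxSr.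
  rewrite exprSr -mulmxE mulmxA -[_ *m A1 *m P]mulmxA AP mulmxDr.
  apply: addmx_sub_adds; last by rewrite mulmxA submxMl.
  by rewrite -[P *m A1 *m P]mulmxA mulmxA; apply: submxMr.
have CAPk (i : 'I_k) : (C1 *m A1 ^+ i *m P <= G k)%MS.
  exact: submx_trans (CAP i) (G_mono _ _ (ltn_ord i)).
have OPG : (obs_mx k A1 C1 *m P <= G k)%MS.
  suff -> : obs_mx k A1 C1 *m P =
      (\mxcol_(i < k) (C1 *m A1 ^+ i *m P *m pinvmx (G k))) *m G k.
    exact: submxMl.
  by rewrite !mxcol_mul; apply: eq_mxcol => i; rewrite mulmxKpV.
(* E embeds the coordinates of S, which shows that P has rank at least |S|. *)
pose E : 'M[R]_(d, #|S|) := colsub enum_val 1%:M.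
have ETPE : E^T *m P *m E = 1%:M.
  apply/matrixP => i i'; rewrite mul_mx_diag !mxE (bigD1 (enum_val i)) //=.
  rewrite big1 => [|u ui]; last by rewrite !mxE (negbTE ui) !mul0r.
  by rewrite !mxE eqxx enum_valP !mul1r addr0 (inj_eq enum_val_inj).
have -> : #|S| = \rank (1%:M : 'M[R]_#|S|) by rewrite mxrank1.
rewrite -ETPE; apply: leq_trans (mxrankM_maxl _ _) _.
apply: leq_trans (mxrankM_maxr _ _) _.
rewrite -[P]mul1mx -(mulVpmx full) -mulmxA; apply: leq_trans (mxrankM_maxr _ _) _.
exact: leq_trans (mxrankS OPG) (rkG k).
Qed.

End Necessity.

Section Sufficiency.
Hypothesis xJ : x \in J.
Variable l : nat.
Hypothesis region_l : forall j, j \in J -> (#|[set v | near v == j]| <= l)%N.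

(** Distinct numbers that grow away from the root. *)
Definition eigenval (v : 'I_d) : nat := h v * d + v.

Lemma eigenval_inj : injective eigenval.
Proof.
move=> u v; rewrite /eigenval => e; apply: val_inj => /=.
by have := congr1 (modn^~ d) e; rewrite !modnMDl !modn_small.
Qed.

Lemma eigenval_p v : v != x -> (eigenval (p v) < eigenval v)%N.
Proof. by move=> /h_p hv; have := ltn_ord (p v); rewrite /eigenval; nia. Qed.

(** The realization in which no signal leaves a sensor towards its parent, so that
    the regions decouple. *)
Definition cut_mx : 'M[R]_d := \matrix_(u, v)
  if u == v then (eigenval v)%:R else ((v \notin J) && (u == p v))%:R.

Definition unit_sensors : 'M[R]_(#|J|, d) :=
  \matrix_(i, v) (enum_val i == v)%:R.

Lemma cut_mxP : realizations A cut_mx.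
Proof.
move=> u v; rewrite A_p negb_or => /andP[uv]; rewrite mxE (negbTE uv).
case: (eqVneq v x) => [->|vx] /=; first by rewrite xJ.
by move=> /negbTE ->; rewrite andbF.
Qed.

Lemma unit_sensorsP : realizations (sensor_mx J) unit_sensors.
Proof. by move=> i v; rewrite !mxE => /negbTE ->. Qed.

Lemma cut_mx_mul (r : 'rV[R]_d) (a : R) v :
  (r *m (cut_mx - a%:M)) 0 v =
  ((eigenval v)%:R - a) * r 0 v + (v \notin J)%:R * r 0 (p v).
Proof.
rewrite mulmxBr mul_mx_scalar !mxE (bigD1 v) //= mxE eqxx.
rewrite mulrBl [r 0 v * _]mulrC addrAC; congr (_ + _).
case: (boolP (v \in J)) => vJ /=.
  rewrite mul0r big1 // => u uv; rewrite mxE (negbTE uv) vJ mulr0 //.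
have vx : v != x by apply: contraNneq vJ => ->.
rewrite (bigD1 (p v)) ?p_neq //= mxE (negbTE (p_neq vx)) vJ eqxx mulr1 mul1r.
rewrite big1 ?addr0 // => u /andP[uv up].
by rewrite mxE (negbTE uv) (negbTE up) andbF mulr0.
Qed.

(** The row e_j times the product of [A - a] over the eigenvalues a < t of the
    region of [j]. *)
Fixpoint annihilator (j : 'I_d) (t : nat) : 'rV[R]_d :=
  if t is t'.+1 then
    if [exists u, (near u == j) && (eigenval u == t')]
    then annihilator j t' *m (cut_mx - t'%:R%:M) else annihilator j t'
  else delta_mx 0 j.

(** Multiplication by [A - a] maps a row r to the row whose entry at a state v that
    is not a sensor is (eigenval v - a) r v + r (p v).  It kills the entry of the
    state with eigenvalue a, as that of the parent is already zero.  At the states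
    not yet killed the factors are positive, so that entries never become negative,
    and the children of killed states have positive entries. *)
Lemma annihilator_support j t v : j \in J ->
  [/\ annihilator j t 0 v != 0 -> near v = j /\ (t <= eigenval v)%N,
      0 <= annihilator j t 0 v
    & near v = j -> (t <= eigenval v)%N ->
      v = j \/ (eigenval (p v) < t)%N -> 0 < annihilator j t 0 v].
Proof.
move=> jJ; elim: t v => [|t IH] v /=.
  rewrite mxE eqxx; case: (eqVneq v j) => [->|vj] /=; split=> //.
  - by rewrite (nearest_id h_p).
  - by rewrite eqxx.
  - by move=> _ _ [/eqP|//]; rewrite (negbTE vj).
have pE : v \notin J -> near (p v) = near v.
  by move=> vJ; rewrite [RHS](nearestE h_p) // (negbTE vJ).
have vJx : v \notin J -> v != x by apply: contraNneq => ->.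
have zero w : ~ (near w = j /\ (t <= eigenval w)%N) -> annihilator j t 0 w = 0.
  by have [H _ _] := IH w; move=> nw; apply/eqP; apply: contraT => /H.
have frontier : v \notin J -> near v = j -> eigenval (p v) = t ->
    0 < annihilator j t 0 (p v).
  move=> vJ nv ev; have [_ _] := IH (p v); apply; rewrite ?pE ?ev //.
  case: (boolP (p v \in J)) => pJ; [left|right].
    by rewrite -[LHS](nearest_id h_p xJ pJ) pE.
  rewrite -ev; apply: eigenval_p; by apply: contraNneq pJ => ->.
have [IH1 IH2 IH3] := IH v.
case: ifP => [/existsP[u /andP[/eqP nu /eqP eu]]|/negbT no]; last first.
  have ne w : near w = j -> eigenval w != t.
    move=> nw; apply: contra no => /eqP ew; apply/existsP.
    by exists w; rewrite nw ew !eqxx.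
  split=> // [/IH1[nv tv]|nv tv fr].
    by split=> //; rewrite ltn_neqAle eq_sym ne.
  apply: IH3 => //; first exact: ltnW.
  case: (boolP (v \in J)) => vJ; first by left; rewrite -(nearest_id h_p xJ vJ).
  case: fr => [|ev]; [by left | right].
  by rewrite ltn_neqAle -ltnS ev andbT ne // pE.
have summand2 : 0 <= (v \notin J)%:R * annihilator j t 0 (p v).
  by apply: mulr_ge0; [apply: ler0n | have [] := IH (p v)].
have summand1 : 0 <= ((eigenval v)%:R - t%:R) * annihilator j t 0 v.
  case: (leqP t (eigenval v)) => tv; first by rewrite mulr_ge0 // subr_ge0 ler_nat.
  by rewrite zero ?mulr0 // => -[_]; lia.
rewrite cut_mx_mul; split=> [||nv tv fr].
- move=> nz; have [nv tv] : near v = j /\ (t < eigenval v)%N; last by [].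
  apply: contrapT => nP; case/eqP: nz.
  have -> : ((eigenval v)%:R - t%:R) * annihilator j t 0 v = 0.
    case: (eqVneq (eigenval v) t) => [->|ne]; first by rewrite subrr mul0r.
    rewrite zero ?mulr0 // => -[nv tv]; apply: nP; split=> //.
    by rewrite ltn_neqAle eq_sym ne.
  rewrite add0r; case: (boolP (v \in J)) => vJ; first by rewrite mul0r.
  rewrite zero ?mulr0 // pE // => -[nv tv]; apply: nP; split=> //.
  by have := eigenval_p (vJx vJ); lia.
- exact: addr_ge0.
case: (boolP (v \in J)) => vJ.
  rewrite mul0r addr0 mulr_gt0 ?subr_gt0 ?ltr_nat //; apply: IH3 => //.
    exact: ltnW.
  by left; rewrite -(nearest_id h_p xJ vJ).
case: fr => [ev|]; first by rewrite ev jJ in vJ.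
rewrite ltnS leq_eqVlt => /predU1P[ev|ev]; rewrite mul1r.
  by apply: ltr_wpDl => //; apply: frontier.
apply: ltr_wpDr; first by rewrite -[X in 0 <= X]mul1r; move: summand2; rewrite vJ.
by rewrite mulr_gt0 ?subr_gt0 ?ltr_nat //; apply: IH3; [|exact: ltnW|right].
Qed.

(** The degree of the annihilator in [A] is the number of eigenvalues below [t]
    in the region. *)
Lemma annihilator_kernel (y : 'cV[R]_d) j t m :
  (forall i, (i < l)%N -> row j (cut_mx ^+ i) *m y = 0) ->
  (#|[set u | (near u == j) && (eigenval u < t)%N]| + m < l)%N ->
  annihilator j t *m cut_mx ^+ m *m y = 0.
Proof.
move=> ker; elim: t m => [|t IH] m /= lt.
  by rewrite -rowE ker //; lia.
set S := [set u | _] in lt; case: ifP => [/existsP[u /andP[nu eu]]|_]; last first.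
  apply: IH; apply: leq_ltn_trans lt; rewrite leq_add2r; apply: subset_leq_card.
  by apply/subsetP => w; rewrite !inE => /andP[-> /ltnW]; rewrite ltnS; lia.
set S' := [set u | (near u == j) && (eigenval u < t)%N] in IH.
have SS : (#|S'| < #|S|)%N.
  apply/proper_card/properP; split.
    by apply/subsetP => w; rewrite !inE => /andP[-> wt] /=; lia.
  by exists u; rewrite !inE nu /= (eqP eu) ?ltnn.
rewrite mulmxBr mul_mx_scalar mulmxBl -scalemxAl mulmxBl.
rewrite -scalemxAl IH; last by apply: ltn_trans lt; rewrite ltn_add2r.
rewrite scaler0 subr0 -[_ *m cut_mx *m _]mulmxA mulmxE -exprS.
by apply: IH; apply: leq_ltn_trans lt; rewrite addnS -addSn leq_add2r.
Qed.

(** Let [v] have the largest eigenvalue in the support of a kernel vector [y].  The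
    annihilator at [t = eigenval v] is supported on eigenvalues at least [t], so it
    meets [y] only at [v], where it is positive. *)
Lemma cut_mx_observable : \rank (obs_mx l cut_mx unit_sensors) = d.
Proof.
rewrite -mxrank_tr; apply/eqP; apply: inj_row_free => z /(congr1 trmx).
rewrite trmx_mul trmxK trmx0 mxcol_mul; set y := z^T => Oy.
have Oz (i : 'I_l) : unit_sensors *m cut_mx ^+ i *m y = 0.
  by have := congr1 (fun M => submxcol M i) Oy; rewrite mxcolK submxcol0.
apply/trmx_inj; rewrite trmx0 -/y; move: y Oz {Oy} => y Oz.
have ker j i : j \in J -> (i < l)%N -> row j (cut_mx ^+ i) *m y = 0.
  move=> jJ il; have := congr1 (row (enum_rank_in jJ j)) (Oz (Ordinal il)).
  rewrite row0 -mulmxA row_mul /= => H; rewrite rowE -mulmxA -[RHS]H.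
  by congr (_ *m _); apply/rowP => v; rewrite !mxE enum_rankK_in // eqxx eq_sym.
apply: contrapT => /eqP nz.
have [v0 yv0] : exists v, y v 0 != 0.
  apply: contrapT => no; case/eqP: nz; apply/colP => v; rewrite mxE; apply/eqP.
  by apply: contraT => nv; case: no; exists v.
case: (@arg_maxnP _ v0 (fun v => y v 0 != 0) eigenval yv0) => v yv vmax.
have jJ := nearest_in h_p v xJ; set j := near v in jJ.
have [_ _ pos] := annihilator_support (eigenval v) v jJ.
have : annihilator j (eigenval v) *m cut_mx ^+ 0 *m y = 0.
  apply: annihilator_kernel => [i|]; first exact: ker.
  rewrite addn0; apply: leq_trans (region_l jJ); apply/proper_card/properP; split.
    by apply/subsetP => u; rewrite !inE => /andP[].
  by exists v; rewrite !inE eqxx //= ltnn.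
move/matrixP => /(_ 0 0); rewrite expr0 mulmx1 !mxE (bigD1 v) //= big1 => [|u uv].
  rewrite addr0 => /eqP; rewrite mulf_eq0 (negbTE yv) orbF gt_eqF // pos //.
  case: (boolP (v \in J)) => vJ; [left | right].
    by rewrite /j (nearest_id h_p).
  by apply: eigenval_p; apply: contraNneq vJ => ->.
have [supp _ _] := annihilator_support (eigenval v) u jJ.
case: (eqVneq (y u 0) 0) => [->|yu]; first by rewrite mulr0.
apply/eqP; rewrite mulf_eq0; apply/orP; left; apply: contraT => /supp[_ le].
have := vmax u yu; move: uv; rewrite -(inj_eq eigenval_inj) => ?; lia.
Qed.

End Sufficiency.

Lemma feasibleP (l : nat) : (0 < l <= d)%N ->
  feasible R A l J <->
  x \in J /\ forall j, j \in J -> (#|[set v | near v == j]| <= l)%N.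
Proof.
case/andP => l0 ld; split.
  case/(feasible_rank R A J ld) => k [A1 [C1 [/andP[k0 kl] A1P C1P rk]]].
  have full : row_full (obs_mx k A1 C1) by apply/eqP.
  split=> [|j jJ]; first exact: root_sensor A1P C1P full.
  exact: leq_trans (region_le A1P C1P full jJ) kl.
case=> xJ reg; apply/(feasible_rank R A J ld).
exists l, cut_mx, unit_sensors; split=> //; first by rewrite l0 /=.
- exact: cut_mxP.
- exact: unit_sensorsP.
- exact: cut_mx_observable.
Qed.

End TreeObservability.

Local Close Scope ring_scope.

(** * Optimality of greedy cutting *)

(** [C] is a top set with threshold [t]; replacing elements by others of smaller
    value, and leaving some out, loses at least [t] per element left out. *)
Lemma top_sum (T : finType) (C X : {set T}) (r : T -> nat) (t : nat) :
  (forall c, c \in C -> t <= r c) -> (forall c, c \in X :\: C -> r c <= t) ->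
  #|X| <= #|C| ->
  \sum_(c in X) r c + t * (#|C| - #|X|) <= \sum_(c in C) r c.
Proof.
move=> tC tX le; rewrite (big_setID C) [leqRHS](big_setID X) /= setIC.
have hX: \sum_(c in X :\: C) r c <= #|X :\: C| * t.
  by rewrite -sum_nat_const; apply: leq_sum.
have hC: #|C :\: X| * t <= \sum_(c in C :\: X) r c.
  rewrite -sum_nat_const; apply: leq_sum => c; rewrite inE => /andP[_].
  exact: tC.
have := cardsID C X; have := cardsID X C; rewrite setIC => eC eX.
have e: #|C| - #|X| = #|C :\: X| - #|X :\: C| by lia.
have leD: #|X :\: C| <= #|C :\: X| by lia.
rewrite e; nia.
Qed.

Section Residuals.
Variables (T : finType) (x : T) (q : T -> T) (h : T -> nat).
Hypothesis h_q : forall v, v != x -> h (q v) < h v.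
Local Notation child := (child x q).

(** [r v] is the size of the piece hanging at [v] after the cuts of [J] below [v]. *)
Definition residual (J : {set T}) (r : T -> nat) (v : T) : Prop :=
  r v = 1 + \sum_(c | child v c && (c \notin J)) r c.

(** Sum the equations of [r] over the region of [j]: the uncut vertices of the
    region cancel. *)
Lemma residual_size (J : {set T}) (r : T -> nat) (near : T -> T) (j : T) :
  x \in J -> (forall v, near v = if v \in J then v else near (q v)) ->
  (forall v, residual J r v) -> j \in J ->
  r j = #|[set v | near v == j]|.
Proof.
move=> xJ nearE rE jJ; pose S v := near v == j.
have Sj: S j by rewrite /S nearE jJ.
have: \sum_(v | S v) r v = #|[set v | near v == j]| +
    \sum_(v | S v) \sum_(c | child v c && (c \notin J)) r c.
  rewrite cardsE -sum1_card -big_split /=.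
  by apply: eq_bigr => v _; rewrite rE.
rewrite sum_children (bigD1 j) //=.
rewrite [in RHS](eq_bigl (fun c => S c && (c != j))); first by lia.
move=> c; rewrite /S (nearE c); case: (boolP (c \in J)) => cJ.
  by rewrite andbF; case: eqP => //= ->; rewrite eqxx.
have -> : c != x by apply: contraNneq cJ => ->.
have -> : c != j by apply: contraNneq cJ => ->.
by rewrite /= !andbT.
Qed.

Lemma residual_bounded (J : {set T}) (r : T -> nat) (near : T -> T) (l : nat) :
  x \in J -> (forall v, near v = if v \in J then v else near (q v)) ->
  (forall v, residual J r v) ->
  (forall j, j \in J -> #|[set v | near v == j]| <= l) -> forall v, r v <= l.
Proof.
move=> xJ nearE rE hJ; apply: (root_ind h_q) => v IH.
case: (boolP (v \in J)) => vJ; first by rewrite (residual_size xJ nearE rE vJ) hJ.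
have vx: v != x by apply: contraNneq vJ => ->.
apply: leq_trans (IH vx); rewrite [r (q v)]rE (bigD1 v) /=; first by lia.
by rewrite /child vx eqxx.
Qed.

(** Summing the equations over the processed set [P] makes uncut pieces cancel;
    what remains counts each vertex of [P] once, in the pieces already cut (first
    sum) or still growing, such as those of [X]. *)
Lemma sum_cut_residuals (J : {set T}) (r : T -> nat) (P X : {set T}) :
  (forall v, v \in P -> residual J r v) ->
  (forall c, c != x -> q c \in P -> c \in P) ->
  (forall c, c \in X -> (c \in P) && (q c \notin P)) ->
  \sum_(v in P) \sum_(c | child v c && (c \in J)) r c + \sum_(c in X) r c
    <= #|P|.
Proof.
move=> rE Pcl XP.
have: \sum_(v in P) r v = #|P| +
    \sum_(v in P) \sum_(c | child v c && (c \notin J)) r c.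
  by rewrite -sum1_card -big_split /=; apply: eq_bigr => v /rE.
rewrite !sum_children; set a := (X in _ = _ + X); set b := (X in _ -> X + _ <= _).
have -> : a = \sum_(c | (c != x) && (q c \in P) && (c \notin J)) r c by [].
suff: b + a + \sum_(c in X) r c <= \sum_(v in P) r v by rewrite /a; lia.
have -> : b + a = \sum_(c | (c != x) && (q c \in P)) r c.
  by rewrite [RHS](bigID (mem J)).
rewrite big_mkcond [X in _ + X <= _]big_mkcond [leqRHS]big_mkcond -big_split /=.
apply: leq_sum => c _; case: ifP => [/andP[cx qc]|_].
  by rewrite (Pcl c) //; case: ifP => [/XP|]; rewrite ?qc ?andbF ?addn0.
by rewrite add0n; case: ifP => // cX; have /andP[-> _] := XP c cX.
Qed.

Lemma sum_card_children :
  \sum_v #|[set c | child v c]| <= #|T|.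
Proof.
have -> : \sum_v #|[set c | child v c]| = \sum_v \sum_(c | child v c && predT c) 1.
  by apply: eq_bigr => v _; rewrite -sum1_card; apply: eq_bigl => c; rewrite inE andbT.
by rewrite sum_children -sum1_card [leqLHS]big_mkcond; apply: leq_sum => c _; case: ifP.
Qed.

Lemma card_cuts (J : {set T}) (N : T -> nat) : x \in J ->
  (forall v, N v = \sum_(c | child v c) ((c \in J) + N c)) -> #|J| = (N x).+1.
Proof.
move=> xJ NE; have: \sum_v N v = \sum_(c | c != x) ((c \in J) + N c).
  rewrite (eq_bigr (fun v => \sum_(c | child v c && predT c) ((c \in J) + N c))).
    by rewrite sum_children; apply: eq_bigl => c; rewrite !andbT.
  by move=> v _; rewrite NE; apply: eq_bigl => c; rewrite andbT.
rewrite (bigD1 x) //= big_split /= => /eqP; rewrite eqn_add2r => /eqP ->.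
rewrite (cardsD1 x) xJ -sum1_card [in RHS]big_mkcond [in LHS]big_mkcond /=.
rewrite add1n; congr _.+1; apply: eq_bigr => c _; rewrite !inE.
by case: (c == x) => //; case: (c \in J).
Qed.

(** The cut children of [v] have values at least [t], the uncut candidates at most
    [t], and undoing a cut of value [t] would exceed [l]. *)
Definition greedy_at (F J : {set T}) (r : T -> nat) (l : nat) (v : T) : Prop :=
  r v <= l /\ exists t, [/\ forall c, child v c -> c \in J -> t <= r c,
    forall c, child v c -> c \in F -> c \notin J -> r c <= t
    & forall c, child v c -> c \in J -> l < t + r v].

(** For a competitor [J'], let [X] be the children of [v] that [J'] cuts or below
    which it makes more cuts than [J].  All other children leave residuals at
    least those of [J], so cutting [X] with the residuals of [J] also fits into
    [l]; hence the greedy set [C] has at most [#|X|] elements, and by [top_sum] it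
    removes at least as much when the numbers agree. *)
Lemma greedy_le (F J J' : {set T}) (r r' N N' : T -> nat) (l : nat) :
  (forall v, q v \in F) -> J' \subset F ->
  (forall v, residual J r v) -> (forall v, greedy_at F J r l v) ->
  (forall v, residual J' r' v) -> (forall v, r' v <= l) ->
  (forall v, N v = \sum_(c | child v c) ((c \in J) + N c)) ->
  (forall v, N' v = \sum_(c | child v c) ((c \in J') + N' c)) ->
  forall v, N v <= N' v /\ (N v = N' v -> r v <= r' v).
Proof.
move=> qF J'F rE gr r'E r'l NE N'E; apply: (leaf_ind h_q) => v IH.
pose C := [set c | child v c & c \in J].
pose X := [set c | child v c & (c \in J') || (N c < N' c)].
have {}IH c : child v c -> N c <= N' c /\ (N c = N' c -> r c <= r' c).
  by case/andP => cx /eqP /IH; apply.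
have N0 c : c \notin F -> N' c = 0.
  move=> cF; rewrite N'E big_pred0 // => e; apply: contraNF cF.
  by case/andP => _ /eqP <-.
have XF c : c \in X -> c \in F.
  rewrite inE => /andP[_ /orP[/(subsetP J'F)//|]]; apply: contraLR.
  by move=> /N0->.
have eN : N v = \sum_(c | child v c) N c + #|C|.
  rewrite NE big_split /= addnC -sum1_card; congr (_ + _).
  rewrite [RHS](eq_bigl (fun c => child v c && (c \in J))); last by move=> c; rewrite inE.
  by rewrite [RHS]big_mkcondr; apply: eq_bigr => c _; case: (c \in J).
have eN' : \sum_(c | child v c) N c + #|X| <= N' v.
  have -> : #|X| = \sum_(c | child v c) (c \in X).
    rewrite -sum1_card [LHS](eq_bigl (fun c => child v c && (c \in X))).
      by rewrite [LHS]big_mkcondr; apply: eq_bigr => c _; case: (c \in X).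
    by move=> c; rewrite inE; case: (child v c).
  rewrite N'E -big_split; apply: leq_sum => c cv /=; rewrite inE cv /=.
  by have [le _] := IH c cv; case: (c \in J') => /=; case: ltnP; lia.
have eR : r v + \sum_(c in C) r c = 1 + \sum_(c | child v c) r c.
  rewrite (rE v) [in RHS](bigID (mem J)) /= -addnA; congr (_ + _); rewrite addnC.
  by congr (_ + _); apply: eq_bigl => c; rewrite inE.
have eR' : 1 + \sum_(c | child v c) r c <= r' v + \sum_(c in X) r c.
  rewrite (r'E v) (bigID (mem X)) /= -addnA leq_add2l addnC.
  apply: leq_add; last first.
    by rewrite big_mkcond [leqRHS]big_mkcond; apply: leq_sum => c _ /=;
       case: ifP => // /andP[_ ->].
  rewrite big_mkcond [leqRHS]big_mkcond; apply: leq_sum => c _.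
  case: ifP => // /andP[cv]; rewrite inE cv /= => /norP[-> /=].
  by rewrite -leqNgt => ge; have [le] := IH c cv; apply; lia.
have [rl [t [tC tX lt]]] := gr v.
have C_t c : c \in C -> t <= r c by rewrite inE => /andP[]; apply: tC.
have X_t c : c \in X :\: C -> r c <= t.
  rewrite inE => /andP[cC cX]; have cF := XF c cX; move: cC cX.
  by rewrite !inE => cC /andP[cv _]; apply: tX => //; rewrite cv in cC.
have CX : #|C| <= #|X|.
  rewrite leqNgt; apply/negP => XC.
  have /set0Pn[c] : C != set0 by rewrite -card_gt0; lia.
  rewrite inE => /andP[cv cJ]; have := lt c cv cJ; have := r'l v.
  by have := top_sum C_t X_t (ltnW XC); nia.
split; first by lia.
move=> eNN; have XC: #|X| = #|C| by lia.
by have := top_sum C_t X_t; rewrite XC leqnn => /(_ isT); lia.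
Qed.

Lemma greedy_card (F J J' : {set T}) (r r' : T -> nat) (l : nat) :
  (forall v, q v \in F) -> x \in J -> x \in J' -> J' \subset F ->
  (forall v, residual J r v) -> (forall v, greedy_at F J r l v) ->
  (forall v, residual J' r' v) -> (forall v, r' v <= l) -> #|J| <= #|J'|.
Proof.
move=> qF xJ xJ' J'F rE gr r'E r'l.
have ex (K : {set T}) : exists N, forall v, N v = \sum_(c | child v c) ((c \in K) + N c).
  have [N NE] := leaf_rec h_q (fun v => \sum_(c | child v c) (c \in K)) predT.
  exists N => v; rewrite NE big_split /=; congr (_ + _).
  by apply: eq_bigl => c; rewrite andbT.
have [[N NE] [N' N'E]] := (ex J, ex J').
rewrite (card_cuts xJ NE) (card_cuts xJ' N'E) ltnS.
by have [] := greedy_le qF J'F rE gr r'E r'l NE N'E x.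
Qed.

End Residuals.

(** * Weakest preconditions with time credits *)

(** [n] is the time that may be spent, and [Q] receives what is left of it. *)
Definition wp (w : nat) (c : prog) (Q : state -> nat -> Prop) (s : state)
    (n : nat) : Prop :=
  exists s' t, [/\ exec w c s s' t, t <= n & Q s' (n - t)].

Section Rules.
Variable w : nat.
Implicit Types (Q I : state -> nat -> Prop) (s : state) (n : nat).

Lemma wp_skip Q s n : 0 < n -> Q s (n - 1) -> wp w Skip Q s n.
Proof. by move=> n0 Qs; exists s, 1; split=> //; apply: ExecSkip. Qed.

Lemma wp_assign Q s n x e : cost e < n -> eval s e <= w ->
  Q (set_reg s x (eval s e)) (n - (cost e).+1) -> wp w (Assign x e) Q s n.
Proof. by move=> tn ew Qs; eexists _, _; split; last exact: Qs; first exact: ExecAssign. Qed.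

Lemma wp_write Q s n a e1 e2 : cost e1 + cost e2 < n ->
  eval s e1 <= w -> eval s e2 <= w ->
  Q (set_cell s a (eval s e1) (eval s e2)) (n - (cost e1 + cost e2).+1) ->
  wp w (Write a e1 e2) Q s n.
Proof.
by move=> tn e1w e2w Qs; eexists _, _; split; last exact: Qs; first exact: ExecWrite.
Qed.

Lemma wp_seq Q s n c1 c2 : wp w c1 (wp w c2 Q) s n -> wp w (Seq c1 c2) Q s n.
Proof.
case=> s1 [t1 [ex1 le1 [s2 [t2 [ex2 le2 Qs]]]]]; exists s2, (t1 + t2).
by split; [exact: ExecSeq ex1 ex2 | lia | rewrite subnDA].
Qed.

Lemma wp_if Q s n e c1 c2 : cost e < n ->
  (eval s e <> 0 -> wp w c1 Q s (n - (cost e).+1)) ->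
  (eval s e = 0 -> wp w c2 Q s (n - (cost e).+1)) ->
  wp w (If e c1 c2) Q s n.
Proof.
move=> tn H1 H2; case: (eqVneq (eval s e) 0) => ev.
  have [s' [t [ex le Qs]]] := H2 ev; exists s', (cost e + t).+1.
  by split; [apply: ExecIfFalse => //; apply/eqP | lia | rewrite -addSn subnDA].
have [s' [t [ex le Qs]]] := H1 (elimN eqP ev); exists s', (cost e + t).+1.
by split; [apply: ExecIfTrue | lia | rewrite -addSn subnDA].
Qed.

Lemma wp_mono Q Q' s n c : (forall s n, Q s n -> Q' s n) ->
  wp w c Q s n -> wp w c Q' s n.
Proof. by move=> QQ' [s' [t [ex le /QQ' Qs]]]; exists s', t. Qed.

Fixpoint regs_of (c : prog) : seq nat :=
  match c with
  | Skip | Write _ _ _ => [::]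
  | Assign x _ => [:: x]
  | Seq c1 c2 | If _ c1 c2 => regs_of c1 ++ regs_of c2
  | While _ c1 => regs_of c1
  end.

Fixpoint arrs_of (c : prog) : seq nat :=
  match c with
  | Skip | Assign _ _ => [::]
  | Write a _ _ => [:: a]
  | Seq c1 c2 | If _ c1 c2 => arrs_of c1 ++ arrs_of c2
  | While _ c1 => arrs_of c1
  end.

Definition framed (c : prog) (s s' : state) : Prop :=
  (forall x, x \notin regs_of c -> regs s' x = regs s x) /\
  (forall a, a \notin arrs_of c -> arrs s' a = arrs s a).

Lemma framed_trans c s1 s2 s3 : framed c s1 s2 -> framed c s2 s3 -> framed c s1 s3.
Proof.
by move=> [r1 a1] [r2 a2]; split=> y yc; [rewrite r2 ?r1 | rewrite a2 ?a1].
Qed.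

Lemma framed_sub c c' s s' : {subset regs_of c <= regs_of c'} ->
  {subset arrs_of c <= arrs_of c'} -> framed c s s' -> framed c' s s'.
Proof.
by move=> sr sa [r a]; split=> y yc; [apply: r | apply: a]; apply: contra yc;
  [apply: sr | apply: sa].
Qed.

(** Registers and arrays that do not occur on the left of an assignment keep
    their values. *)
Lemma exec_framed c s s' t : exec w c s s' t -> framed c s s'.
Proof.
elim=> {c s s' t} // [s x e _|s a e1 e2 _ _|c1 c2 s1 s2 s3 t1 t2 _ f1 _ f2|
    e c1 c2 s s' t _ _ f|e c1 c2 s s' t _ _ f|e c s1 s2 s3 t1 t2 _ _ f1 _ f2].
- by split=> // y; rewrite inE /= /upd => /negbTE ->.
- by split=> // y; rewrite inE /= /upd => /negbTE ->.
- apply: (@framed_trans _ _ s2).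
    by apply: framed_sub f1 => y /=; rewrite mem_cat => ->.
  by apply: framed_sub f2 => y /=; rewrite mem_cat => ->; rewrite orbT.
- by apply: framed_sub f => y /=; rewrite mem_cat => ->.
- by apply: framed_sub f => y /=; rewrite mem_cat => ->; rewrite orbT.
- exact: framed_trans f1 f2.
Qed.

Lemma wp_framed Q s n c :
  wp w c (fun s' n' => framed c s s' -> Q s' n') s n -> wp w c Q s n.
Proof.
by case=> s' [t [ex le Qs]]; exists s', t; split=> //; apply: Qs; apply: exec_framed ex.
Qed.

(** Each iteration consumes a positive number of credits, so the credits serve as
    the termination measure. *)
Lemma wp_while I Q s n e c : I s n ->
  (forall s' n', framed c s s' -> I s' n' ->
    [/\ cost e < n', eval s' e = 0 -> Q s' (n' - (cost e).+1)
      & eval s' e <> 0 -> wp w c I s' (n' - (cost e).+1)]) ->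
  wp w (While e c) Q s n.
Proof.
move=> Is step.
suff H m s' n' : n' < m -> framed c s s' -> I s' n' -> wp w (While e c) Q s' n'.
  by apply: (H n.+1).
elim: m s' n' => // m IH s' n' n'm fr Is'; have [tn' st0 st1] := step s' n' fr Is'.
case: (eqVneq (eval s' e) 0) => ev.
  exists s', (cost e).+1; split=> //; last exact: st0.
  by apply: ExecWhileFalse; apply/eqP.
have [s1 [t1 [ex1 le1 I1]]] := st1 (elimN eqP ev).
have [||s2 [t2 [ex2 le2 Q2]]] := IH s1 _ _ _ I1; first by lia.
  exact: framed_trans fr (exec_framed ex1).
exists s2, (cost e + t1 + t2).+1; split; first exact: ExecWhileTrue ex1 ex2.
  by lia.
by move: Q2; congr (Q _ _); lia.
Qed.

End Rules.

Arguments upd _ _ _ _ _ /.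
Arguments set_reg _ _ _ /.
Arguments set_cell _ _ _ _ /.

(** * The program *)

(** Registers [rD], [rL] and [rM] hold the input sizes.  [rI] counts iterations, [rV]
    is the current vertex and [rT] the length of the queue; [rR] is the size of the
    piece at [rV] and [rS] a bucket number; [rC], [rK] and [rU] are temporary.

    [aPar] holds parents, shifted by one so that 0 marks the root; [aDeg] the
    numbers of unprocessed children; [aOrd] the leaves-first order; [aAnc] the
    nearest vertices of F; [aSum] the total size of the children processed so
    far; [aRes] the residuals.  [aFst] holds the heads of the lists of candidate
    children and [aBkt] those of the buckets; both kinds of list are linked by
    [aNxt], with the vertex c encoded as c + 1 and 0 for the end. *)
Notation rD := 0 (only parsing).
Notation rL := 1 (only parsing).
Notation rM := 2 (only parsing).
Notation rI := 3 (only parsing).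
Notation rV := 4 (only parsing).
Notation rC := 5 (only parsing).
Notation rK := 6 (only parsing).
Notation rR := 7 (only parsing).
Notation rS := 8 (only parsing).
Notation rU := 9 (only parsing).
Notation rT := 10 (only parsing).
Notation aTail := 0 (only parsing).
Notation aHead := 1 (only parsing).
Notation aF := 2 (only parsing).
Notation aOut := 3 (only parsing).
Notation aPar := 4 (only parsing).
Notation aDeg := 5 (only parsing).
Notation aOrd := 6 (only parsing).
Notation aAnc := 7 (only parsing).
Notation aSum := 8 (only parsing).
Notation aFst := 9 (only parsing).
Notation aNxt := 10 (only parsing).
Notation aRes := 11 (only parsing).
Notation aBkt := 12 (only parsing).

Definition incr (x : nat) : prog := Assign x (Add (Reg x) (Const 1)).

(** The test is the absolute difference of the two endpoints, which skips
    self-loops. *)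
Definition parents_prog : prog :=
  Seq (Assign rI (Const 0))
  (While (Sub (Reg rM) (Reg rI))
    (Seq (If (Add (Sub (Read aTail (Reg rI)) (Read aHead (Reg rI)))
                  (Sub (Read aHead (Reg rI)) (Read aTail (Reg rI))))
             (Write aPar (Read aTail (Reg rI)) (Add (Read aHead (Reg rI)) (Const 1)))
             Skip)
         (incr rI))).

Definition degrees_prog : prog :=
  Seq (Assign rI (Const 0))
  (While (Sub (Reg rD) (Reg rI))
    (Seq (If (Read aPar (Reg rI))
             (Write aDeg (Sub (Read aPar (Reg rI)) (Const 1))
               (Add (Read aDeg (Sub (Read aPar (Reg rI)) (Const 1))) (Const 1)))
             Skip)
         (incr rI))).

Definition push (e : expr) : prog := Seq (Write aOrd (Reg rT) e) (incr rT).

Definition leaves_prog : prog :=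
  Seq (Assign rI (Const 0)) (Seq (Assign rT (Const 0))
  (While (Sub (Reg rD) (Reg rI))
    (Seq (If (Read aDeg (Reg rI)) Skip (push (Reg rI)))
         (incr rI)))).

(** The array [aOrd] is at once the queue and the resulting order. *)
Definition queue_prog : prog :=
  Seq (Assign rI (Const 0))
  (While (Sub (Reg rD) (Reg rI))
    (Seq (Assign rV (Read aOrd (Reg rI)))
    (Seq (If (Read aPar (Reg rV))
             (Seq (Assign rU (Sub (Read aPar (Reg rV)) (Const 1)))
             (Seq (Write aDeg (Reg rU) (Sub (Read aDeg (Reg rU)) (Const 1)))
                  (If (Read aDeg (Reg rU)) Skip (push (Reg rU)))))
             Skip)
         (incr rI)))).

Definition ancestors_prog : prog :=
  Seq (Assign rI (Reg rD))
  (While (Reg rI)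
    (Seq (Assign rI (Sub (Reg rI) (Const 1)))
    (Seq (Assign rV (Read aOrd (Reg rI)))
         (If (Read aF (Reg rV))
             (Write aAnc (Reg rV) (Reg rV))
             (Write aAnc (Reg rV)
               (Read aAnc (Sub (Read aPar (Reg rV)) (Const 1)))))))).

(** Moves the list of candidate children of the current vertex into buckets by
    residual and leaves the largest residual in [rS]. *)
Definition bucket_prog : prog :=
  Seq (Assign rC (Read aFst (Reg rV)))
  (Seq (Assign rS (Const 0))
  (While (Reg rC)
    (Seq (Assign rU (Read aNxt (Sub (Reg rC) (Const 1))))
    (Seq (Assign rK (Read aRes (Sub (Reg rC) (Const 1))))
    (Seq (Write aNxt (Sub (Reg rC) (Const 1)) (Read aBkt (Reg rK)))
    (Seq (Write aBkt (Reg rK) (Reg rC))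
    (Seq (If (Sub (Reg rK) (Reg rS)) (Assign rS (Reg rK)) Skip)
         (Assign rC (Reg rU))))))))).

(** Empties the buckets from the largest residual down, cutting children as long
    as the piece is too large.  It runs on after that, so that every bucket is
    empty again for the next sort. *)
Definition cut_prog : prog :=
  While (Reg rS)
    (Seq (Assign rC (Read aBkt (Reg rS)))
         (If (Reg rC)
             (Seq (Write aBkt (Reg rS) (Read aNxt (Sub (Reg rC) (Const 1))))
                  (If (Sub (Reg rR) (Reg rL))
                      (Seq (Write aOut (Sub (Reg rC) (Const 1)) (Const 1))
                           (Assign rR (Sub (Reg rR) (Reg rS))))
                      Skip))
             (Assign rS (Sub (Reg rS) (Const 1))))).

Definition overflow_prog : prog :=
  If (Sub (Reg rR) (Reg rL)) (Seq bucket_prog cut_prog) Skip.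

(** Adds the current piece to its parent in the contracted tree; the root is
    always chosen. *)
Definition attach_prog : prog :=
  If (Read aPar (Reg rV))
     (Seq (Assign rU (Read aAnc (Sub (Read aPar (Reg rV)) (Const 1))))
     (Seq (Write aSum (Reg rU) (Add (Read aSum (Reg rU)) (Reg rR)))
          (If (Read aF (Reg rV))
              (Seq (Write aNxt (Reg rV) (Read aFst (Reg rU)))
                   (Write aFst (Reg rU) (Add (Reg rV) (Const 1))))
              Skip)))
     (Write aOut (Reg rV) (Const 1)).

Definition greedy_prog : prog :=
  Seq (Assign rI (Const 0))
  (While (Sub (Reg rD) (Reg rI))
    (Seq (Assign rV (Read aOrd (Reg rI)))
    (Seq (Assign rR (Add (Read aSum (Reg rV)) (Const 1)))
    (Seq overflow_prog
    (Seq (Write aRes (Reg rV) (Reg rR))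
    (Seq attach_prog
         (incr rI))))))).

Definition sensor_prog : prog :=
  Seq parents_prog (Seq degrees_prog (Seq leaves_prog
    (Seq queue_prog (Seq ancestors_prog greedy_prog)))).

Ltac arith :=
  repeat match goal with
  | H : is_true (_ \in _) |- _ => clear H
  | H : is_true (~~ _) |- _ => clear H
  | H : is_true (uniq _) |- _ => clear H
  end; lia.

Ltac wps := repeat first
  [ apply: wp_seq | apply: wp_assign => /= | apply: wp_write => /= | apply: wp_skip => /= ].

(** * Parents, a leaves-first order, and nearest candidates *)

Section Preparation.
Variables (d : nat) (x : 'I_d) (p : 'I_d -> 'I_d) (h : 'I_d -> nat).
Hypothesis h_p : forall v, v != x -> h (p v) < h v.
Variable w : nat.
Hypothesis w_big : d + d < w.

Definition parents_in (s : state) : Prop :=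
  forall v : 'I_d, arrs s aPar v = if v == x then 0 else (p v).+1.

Section Edges.
Variable es : seq ('I_d * 'I_d).
Hypothesis es_uniq : uniq es.
Hypothesis es_mem : forall u v, ((u, v) \in es) = (v == u) || ((u != x) && (v == p u)).

(** Besides the self-loops there is one edge for each vertex but the root. *)
Lemma size_es : size es <= d + d.
Proof.
pose es' := [seq (u, u) | u <- enum 'I_d] ++ [seq (u, p u) | u <- enum 'I_d].
have -> : d + d = size es' by rewrite size_cat !size_map -enumT size_enum_ord.
apply: uniq_leq_size => // -[u v]; rewrite es_mem mem_cat.
case/orP=> [/eqP->|/andP[_ /eqP->]]; apply/orP; [left|right];
  by apply/mapP; exists u; rewrite ?mem_enum.
Qed.

Lemma parents_wp s n : regs s rM = size es ->
  (forall i, arrs s aTail i = nth 0 [seq val e.1 | e <- es] i) ->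
  (forall i, arrs s aHead i = nth 0 [seq val e.2 | e <- es] i) ->
  (forall i, arrs s aPar i = 0) -> 60 * d + 30 <= n ->
  wp w parents_prog (fun s' n' => parents_in s' /\ n <= n' + (60 * d + 30)) s n.
Proof.
move=> sM sT sH sP hn; have es_d := size_es.
wps; [lia | lia |].
pose I s' n' := exists i, [/\ regs s' rI = i, i <= size es, n <= n' + 30 * i + 5
  & forall v : 'I_d, arrs s' aPar v =
      if (v != x) && ((v, p v) \in take i es) then (p v).+1 else 0].
apply: (@wp_while _ I).
  by exists 0; split=> //=; [lia | move=> v; rewrite take0 andbF].
move=> s' n' [/= fr fa] [i [sI i_le hn' sP']]; rewrite /= sI fr //= sM.
split=> [|i_m|i_m]; first by arith.
  have ei : i = size es by arith.
  split; last by arith.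
  move=> v; rewrite sP' ei take_size es_mem eqxx andbT.
  by case: (eqVneq v x) => //= _; rewrite orbT.
have {i_m}i_lt : i < size es by arith.
have [u [v eis]] : exists u v, nth (x, x) es i = (u, v).
  by case: nth => u v; exists u, v.
have sTi : arrs s' aTail i = u by rewrite fa // sT (nth_map (x, x)) // eis.
have sHi : arrs s' aHead i = v by rewrite fa // sH (nth_map (x, x)) // eis.
have uv_es : (v == u) || ((u != x) && (v == p u)).
  by rewrite -es_mem -eis mem_nth.
have Ii1 (v' : 'I_d) : ((v', p v') \in take i.+1 es) =
    ((v', p v') == (u, v)) || ((v', p v') \in take i es).
  by rewrite (take_nth (x, x)) // mem_rcons inE eis.
apply: wp_seq; apply: wp_if => /=; first by arith.
  rewrite sI sTi sHi => uv; wps; rewrite ?sI ?sTi ?sHi; try arith.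
  - by have := ltn_ord u; lia.
  - by have := ltn_ord v; lia.
  exists i.+1; split=> /=; rewrite ?sI ?sTi ?sHi; try arith.
  move=> v'; rewrite Ii1 xpair_eqE sP'.
  move: uv_es; case: (eqVneq v u) => [e|vu]; first by case: uv; rewrite e; lia.
  case/andP=> ux /eqP ev; rewrite val_eqE; case: eqP => [->|_] //=.
  by rewrite ux ev eqxx addn1.
rewrite sI sTi sHi => uv; wps; rewrite ?sI; try arith.
exists i.+1; split=> /=; rewrite ?sI; try arith.
move=> v'; rewrite Ii1 xpair_eqE sP'; case: (eqVneq v' x) => //= v'x.
have -> : v = u by apply: val_inj => /=; lia.
case: (eqVneq v' u) => //= e; have := h_p v'x; rewrite -e.
by case: eqP => // ->; rewrite ltnn.
Qed.

End Edges.

Definition kids (v : 'I_d) : {set 'I_d} := [set c | child x p v c].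

Lemma in_kids v c : (c \in kids v) = (c != x) && (v == p c).
Proof. by rewrite inE /child [p c == v]eq_sym. Qed.

Lemma card_below (K : {set 'I_d}) (u : 'I_d) :
  #|[set c in K | c < u.+1]| = (u \in K) + #|[set c in K | c < u]|.
Proof.
rewrite (cardsD1 u) !inE ltnSn andbT; congr (_ + _); apply: eq_card => c.
by rewrite !inE ltnS [in RHS]ltn_neqAle andbCA val_eqE.
Qed.

Lemma card_pop (K : {set 'I_d}) (o : seq 'I_d) (u : 'I_d) : u \notin o ->
  #|[set c in K | c \notin o]| =
  (u \in K) + #|[set c in K | c \notin rcons o u]|.
Proof.
move=> uo; rewrite (cardsD1 u) !inE uo andbT; congr (_ + _); apply: eq_card => c.
by rewrite !inE mem_rcons inE negb_or andbCA.
Qed.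

Lemma degrees_wp s n : regs s rD = d -> parents_in s ->
  (forall i, arrs s aDeg i = 0) -> 60 * d + 30 <= n ->
  wp w degrees_prog (fun s' n' =>
    (forall v : 'I_d, arrs s' aDeg v = #|kids v|) /\ n <= n' + (60 * d + 30)) s n.
Proof.
move=> sD sP sDeg hn.
wps; [lia | lia |].
pose I s' n' := exists i, [/\ regs s' rI = i, i <= d, n <= n' + 60 * i + 5
  & forall v : 'I_d, arrs s' aDeg v = #|[set c in kids v | c < i]|].
apply: (@wp_while _ I).
  exists 0; split=> //=; [lia | move=> v; rewrite sDeg].
  by apply/esym/eqP; rewrite cards_eq0 -subset0; apply/subsetP => c; rewrite !inE andbF.
move=> s' n' [/= fr fa] [i [sI i_le hn' sI']]; rewrite /= sI fr //= sD.
split=> [|i_m|i_m]; first by arith.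
  have ei : i = d by arith.
  split; last by arith.
  move=> v; rewrite sI' ei; apply: eq_card => c.
  by rewrite !inE ltn_ord andbT.
have {i_m}i_lt : i < d by arith.
pose u := Ordinal i_lt.
have sPi : arrs s' aPar i = if u == x then 0 else (p u).+1 by rewrite fa // (sP u).
apply: wp_seq; apply: wp_if => /=; rewrite ?sI ?sPi; first by arith.
  case: eqP => // /eqP ux _; have := ltn_ord (p u) => pu.
  have le_d : #|[set c in kids (p u) | c < i]| <= d.
    by rewrite -[leqRHS]card_ord max_card.
  wps; rewrite ?sI ?sPi ?(negbTE ux) ?subn1 /= ?sI'; try arith.
  exists i.+1; split; rewrite /= ?sI ?sPi ?(negbTE ux) ?subn1 /=; try arith.
  move=> v; rewrite !sI' (card_below _ u) in_kids ux /= val_eqE.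
  by case: eqP => [->|]; rewrite ?addn1 ?add1n.
case: eqP => // ux _; wps; rewrite ?sI; try arith.
exists i.+1; split; rewrite /= ?sI; try arith.
by move=> v; rewrite sI' (card_below _ u) in_kids (introT eqP ux).
Qed.

Definition queue_in (s : state) (o : seq 'I_d) : Prop :=
  regs s rT = size o /\
  forall k, k < size o -> arrs s aOrd k = nth 0 (map val o) k.

Lemma uniq_size_ord (o : seq 'I_d) : uniq o -> size o <= d.
Proof. by move=> /card_uniqP <-; rewrite -[leqRHS]card_ord max_card. Qed.

(** The enlarged queue has no repetition, so its length fits into a word. *)
Lemma push_wp s n o e (u : 'I_d) (Q : state -> nat -> Prop) :
  queue_in s o -> uniq (rcons o u) -> eval s e = u -> cost e + 10 <= n ->
  (forall s', queue_in s' (rcons o u) ->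
     framed (push e) s s' -> Q s' (n - (cost e + 6))) ->
  wp w (push e) Q s n.
Proof.
move=> [sT sO] /uniq_size_ord; rewrite size_rcons => o_d eu hn QP.
apply: wp_framed; have u_d := ltn_ord u.
wps; rewrite ?sT ?eu; try arith.
move=> fr; have -> : n - (1 + cost e).+1 - (1 + 1).+2 = n - (cost e + 6) by arith.
apply: QP => //; split=> /=; rewrite ?sT ?size_rcons ?addn1 // => k k_o.
rewrite map_rcons nth_rcons size_map.
by case: (ltngtP k (size o)) k_o => [k_o _|o_k|//]; [rewrite sO | arith].
Qed.

Lemma leaves_wp s n : regs s rD = d ->
  (forall v : 'I_d, arrs s aDeg v = #|kids v|) -> 60 * d + 30 <= n ->
  wp w leaves_prog (fun s' n' => (exists o, [/\ queue_in s' o, uniq o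
      & forall v, (v \in o) = (#|kids v| == 0)]) /\ n <= n' + (60 * d + 30)) s n.
Proof.
move=> sD sDeg hn.
wps; [lia | lia | lia | lia |].
pose I s' n' := exists i o, [/\ regs s' rI = i, i <= d, n <= n' + 60 * i + 10
  & [/\ queue_in s' o, uniq o
      & forall v : 'I_d, (v \in o) = (#|kids v| == 0) && (v < i)]].
apply: (@wp_while _ I).
  exists 0, [::]; split=> //=; [lia|split=> //].
  by move=> v; rewrite andbF.
move=> s' n' [/= fr fa] [i [o [sI i_le hn' [sQ o_uniq o_mem]]]].
rewrite /= sI fr //= sD.
split=> [|i_m|i_m]; first by arith.
  have ei : i = d by arith.
  split; last by arith.
  by exists o; split=> // v; rewrite o_mem ei ltn_ord andbT.
have {i_m}i_lt : i < d by arith.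
pose u := Ordinal i_lt; have sDi : arrs s' aDeg i = #|kids u| by rewrite fa // (sDeg u).
have lt_S (v : 'I_d) : (v < i.+1) = (v == u) || (v < i).
  by rewrite ltnS leq_eqVlt -val_eqE.
apply: wp_seq; apply: wp_if => /=; rewrite ?sI ?sDi; first by arith.
  move=> ku; wps; rewrite ?sI; try arith.
  exists i.+1, o; split; rewrite /= ?sI; try arith; split=> //.
  move=> v; rewrite o_mem lt_S; case: (eqVneq v u) => //= ->.
  by rewrite ltnn andbF andbT; apply/esym/eqP.
move=> ku; apply: (push_wp (u := u) sQ) => //=; try arith.
  by rewrite rcons_uniq o_uniq o_mem /= ltnn andbF.
move=> s1 sQ1 [/= fr1 fa1]; wps; rewrite ?fr1 ?sI //; try arith.
exists i.+1, (rcons o u); split; rewrite /= ?fr1 ?sI //; try arith; split=> //.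
  by rewrite rcons_uniq o_uniq o_mem /= ltnn andbF.
move=> v; rewrite mem_rcons inE o_mem lt_S; case: (eqVneq v u) => //= ->.
by rewrite ku.
Qed.

Definition children_first (o : seq 'I_d) : Prop :=
  forall v c, v \in o -> c \in kids v -> index c o < index v o.

(** All vertices, children before parents. *)
Definition leaf_order (o : seq 'I_d) : Prop :=
  [/\ uniq o, size o = d & forall v c, c \in kids v -> index c o < index v o].

Lemma mem_full (o : seq 'I_d) (v : 'I_d) : uniq o -> size o = d -> v \in o.
Proof.
move=> o_uniq o_d; have sub : {subset o <= enum 'I_d} by move=> u _; rewrite mem_enum.
have [|_ ->] := uniq_min_size o_uniq sub; last by rewrite mem_enum.
by rewrite size_enum_ord o_d.
Qed.

(** When all vertices in the queue are processed and exactly those vertices are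
    queued all of whose children are processed, every vertex is queued. *)
Lemma queue_progress (o : seq 'I_d) : uniq o ->
  (forall v, (v \in o) = (#|[set c in kids v | c \notin o]| == 0)) -> size o = d.
Proof.
move=> o_uniq o_mem; have all_o v : v \in o.
  elim/(leaf_ind h_p): v => v IH; rewrite o_mem cards_eq0 -subset0.
  apply/subsetP => c; rewrite inE in_kids => /andP[/andP[cx /eqP e]].
  by rewrite IH.
rewrite -[RHS]card_ord -(card_uniqP o_uniq); apply: eq_card => v.
by rewrite all_o.
Qed.

(** Invariant: the degree of a vertex counts its children outside the processed
    prefix [take i o], and the queued vertices are those of degree zero. *)
Lemma queue_wp s n o0 : regs s rD = d -> parents_in s ->
  (forall v : 'I_d, arrs s aDeg v = #|kids v|) ->
  queue_in s o0 -> uniq o0 -> (forall v, (v \in o0) = (#|kids v| == 0)) ->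
  80 * d + 30 <= n ->
  wp w queue_prog (fun s' n' => (exists o, queue_in s' o /\ leaf_order o) /\
    n <= n' + (80 * d + 30)) s n.
Proof.
move=> sD sP sDeg sQ0 o0_uniq o0_mem hn.
wps; [lia | lia |].
pose I s' n' := exists i o, [/\ regs s' rI = i, i <= size o, n <= n' + 80 * i + 10,
    queue_in s' o & [/\ uniq o, children_first o,
    forall v : 'I_d, arrs s' aDeg v = #|[set c in kids v | c \notin take i o]|
  & forall v, (v \in o) = (#|[set c in kids v | c \notin take i o]| == 0)]].
apply: (@wp_while _ I).
  have e v : [set c in kids v | c \notin take 0 o0] = kids v.
    by apply/setP => c; rewrite inE take0 andbT.
  exists 0, o0; split=> //=; [lia|split=> // v]; rewrite ?e //.
  by move=> c; rewrite o0_mem cards_eq0 => /eqP ->; rewrite inE.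
move=> s' n' [/= fr fa] [i [o [sI i_le hn' sQ [o_uniq o_first sDeg' o_mem]]]].
have o_d := uniq_size_ord o_uniq.
rewrite /= sI fr //= sD.
split=> [|i_m|i_m]; first by arith.
  have [ei eo] : i = d /\ size o = d by arith.
  split; last by arith.
  exists o; split=> //; split=> // v c; apply: o_first.
  exact: mem_full.
have {i_m}i_d : i < d by arith.
have i_o : i < size o.
  rewrite ltn_neqAle i_le andbT; apply/eqP => ei; move: i_d; rewrite ei.
  rewrite (queue_progress o_uniq) ?ltnn // => v.
  by rewrite o_mem ei take_size.
pose v := nth x o i.
have tE : take i.+1 o = rcons (take i o) v by rewrite (take_nth x).
have v_o : v \in o by apply: mem_nth.
have v_new : v \notin take i o.
  by rewrite in_take // index_uniq // ltnn.
have sOi : arrs s' aOrd i = v by rewrite sQ.2 // (nth_map x).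
have sPv : arrs s' aPar v = if v == x then 0 else (p v).+1 by rewrite fa // sP.
have degE u : #|[set c in kids u | c \notin take i o]| =
    ((v != x) && (u == p v)) + #|[set c in kids u | c \notin take i.+1 o]|.
  by rewrite (card_pop _ v_new) in_kids tE.
have v_d := ltn_ord v; have pv_d := ltn_ord (p v).
wps; rewrite ?sI ?sOi; try arith.
apply: wp_if => /=; rewrite ?sPv; first by arith.
  case: eqP => // /eqP vx _; rewrite vx /= in degE.
  have degv := degE (p v); rewrite eqxx add1n in degv.
  have deg_d : #|[set c in kids (p v) | c \notin take i o]| <= d.
    by rewrite -[leqRHS]card_ord max_card.
  rewrite degv in deg_d; set D := #|_| in deg_d degv.
  have {}deg_d : D <= w by arith.
  wps; rewrite ?sPv ?(negbTE vx) ?subn1 /= ?sDeg' ?degv /=; try arith.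
  set s1 := (X in wp _ _ _ X _).
  have sDeg1 (u : 'I_d) : arrs s1 aDeg u = #|[set c in kids u | c \notin take i.+1 o]|.
    rewrite /= val_eqE sDeg' degE; case: eqP => [->|_]; last by rewrite add0n.
    by [].
  have sQ1 : queue_in s1 o by split; [exact: sQ.1 | exact: sQ.2].
  have sI1 : regs s1 rI = i by [].
  have s1U : regs s1 rU = p v by []. clearbody s1.
  apply: wp_if; [rewrite /=; arith | |]; rewrite [eval _ _]/= s1U sDeg1 -/D => z.
    wps; rewrite ?sI1; try arith.
    exists i.+1, o; split=> //=; rewrite ?sI1; try arith.
    split=> // u; rewrite o_mem degE; case: (eqVneq u (p v)) => [->|_] //=.
    by rewrite -/D; apply/esym/eqP.
  have pv_new : p v \notin o by rewrite o_mem degv.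
  have o'_uniq : uniq (rcons o (p v)) by rewrite rcons_uniq pv_new.
  have take' : take i.+1 (rcons o (p v)) = take i.+1 o.
    by rewrite -cats1 takel_cat.
  apply: (push_wp (u := p v) sQ1) => //; first by rewrite /=; arith.
  move=> s2 sQ2 [/= fr2 fa2]; wps; rewrite ?fr2 ?sI1 //; try arith.
  exists i.+1, (rcons o (p v)); split=> //=; rewrite ?fr2 ?sI1 ?size_rcons //; try arith.
  split=> // [u c|u|u].
  - have idx a : a \in o -> index a (rcons o (p v)) = index a o.
      by move=> a_o; rewrite -cats1 index_cat a_o.
    rewrite mem_rcons inE => /predU1P[->|u_o] cu; last first.
      rewrite idx // idx ?o_first // -index_mem.
      by apply: ltn_trans (o_first _ _ u_o cu) _; rewrite index_mem.
    have c_take : c \in take i.+1 o.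
      apply: contraT => c_new; have : c \in [set c in kids (p v) | c \notin take i.+1 o].
        by rewrite inE cu.
      by move/eqP: z; rewrite cards_eq0 => /eqP ->; rewrite inE.
    have c_o := mem_take c_take.
    by rewrite (idx c c_o) -cats1 index_cat (negbTE pv_new) /= eqxx addn0 index_mem.
  - by rewrite take' fa2 // sDeg1.
  rewrite take' mem_rcons inE o_mem degE; case: (eqVneq u (p v)) => [->|_] //=.
  by rewrite -/D z.
case: eqP => // vx _; rewrite vx eqxx in degE.
wps; rewrite ?sI; try arith.
exists i.+1, o; split=> /=; rewrite ?sI //; try arith; split=> // u.
  by rewrite sDeg' degE.
by rewrite o_mem degE.
Qed.

Variable F : {set 'I_d}.
Hypothesis xF : x \in F.

(** The order is traversed backwards, so parents come first; the positions from
    [i] on are done. *)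
Definition anc_from (o : seq 'I_d) (i : nat) (s : state) : Prop :=
  forall v : 'I_d, i <= index v o -> arrs s aAnc v = nearest p h F v.

Lemma ancestors_wp s n o : regs s rD = d -> parents_in s ->
  (forall v : 'I_d, arrs s aF v = (v \in F)) -> queue_in s o -> leaf_order o ->
  60 * d + 30 <= n ->
  wp w ancestors_prog (fun s' n' => anc_from o 0 s' /\
    n <= n' + (60 * d + 30)) s n.
Proof.
move=> sD sP sF sQ [o_uniq o_d o_first] hn.
wps; [lia | lia |].
pose I s' n' := exists i, [/\ regs s' rI = i, i <= d, n <= n' + 60 * (d - i) + 5
  & anc_from o i s'].
apply: (@wp_while _ I).
  exists d; split=> //=; rewrite ?subnn; try arith.
  by move=> v; have := index_mem v o; rewrite mem_full // o_d => ?; lia.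
move=> s' n' [/= fr fa] [i [sI i_le hn' sA]]; rewrite /= sI.
split=> [|i0|i_pos]; first by arith.
  by rewrite i0 in sA hn'; split; last lia.
case: i sI i_le hn' sA i_pos => // i sI i_lt hn' sA _.
have i_o : i < size o by rewrite o_d.
pose v := nth x o i.
have sOi : arrs s' aOrd i = v by rewrite fa // sQ.2 // (nth_map x).
have sPv : arrs s' aPar v = if v == x then 0 else (p v).+1 by rewrite fa // sP.
have sFv : arrs s' aF v = (v \in F) by rewrite fa // sF.
have v_d := ltn_ord v; have iv : index v o = i by rewrite index_uniq.
have idx u : i <= index u o -> u = v \/ i < index u o.
  rewrite leq_eqVlt => /predU1P[e|]; [left | by right].
  by rewrite /v e nth_index // mem_full.
wps; rewrite ?sI ?subn1 /= ?sOi; try arith.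
apply: wp_if => /=; rewrite ?sFv; first by arith.
  case: (boolP (v \in F)) => // vF _; wps; try arith.
  exists i; split=> //=; try arith.
  move=> u /idx; rewrite /= val_eqE => -[->|iu]; first by rewrite eqxx (nearest_id h_p).
  case: eqP => [->|_]; first by rewrite (nearest_id h_p).
  exact: sA.
case: (boolP (v \in F)) => // vF _.
have vx : v != x by apply: contraNneq vF => ->.
have sAp : arrs s' aAnc (p v) = nearest p h F v.
  rewrite sA; first by rewrite [in RHS](nearestE h_p) // (negbTE vF).
  by rewrite -iv o_first // in_kids vx eqxx.
have := ltn_ord (nearest p h F v) => near_d.
wps; rewrite ?sPv ?(negbTE vx) ?subn1 /= ?sAp; try arith.
exists i; split=> //=; try arith.
move=> u /idx; rewrite /= val_eqE => -[->|iu]; first by rewrite eqxx.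
by case: eqP => [->|_] //; apply: sA.
Qed.

End Preparation.

(** * Cutting the largest children *)

Section Buckets.
Variables (d w : nat).
Hypothesis w_big : d + d < w.

(** The code [a] is the head of a linked list with elements [L]. *)
Fixpoint linked (nxt : nat -> nat) (a : nat) (L : seq 'I_d) : Prop :=
  if L is c :: L' then a = c.+1 /\ linked nxt (nxt c) L' else a = 0.

Lemma linked_eq (nxt nxt' : nat -> nat) a (L : seq 'I_d) :
  (forall c, c \in L -> nxt' c = nxt c) -> linked nxt a L -> linked nxt' a L.
Proof.
elim: L a => //= c L IH a e [-> lL]; split=> //.
rewrite e ?mem_head //; apply: IH lL => b bL.
by rewrite e // inE bL orbT.
Qed.

Lemma linked_le (nxt : nat -> nat) a (L : seq 'I_d) : linked nxt a L -> a <= d.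
Proof. by case: L => [->|c L [-> _]]. Qed.

(** Invariant: the list [L] is split into the part [D] already distributed, in
    reverse order because elements are pushed in front, and the rest [K]; bucket
    [k] lists the elements of [D] with residual [k]. *)
Lemma bucket_wp s n (v : 'I_d) (L : seq 'I_d) :
  regs s rV = v -> linked (arrs s aNxt) (arrs s aFst v) L -> uniq L ->
  (forall k, arrs s aBkt k = 0) -> (forall c, c \in L -> arrs s aRes c <= d) ->
  100 * size L + 30 <= n ->
  wp w bucket_prog (fun s' n' => n <= n' + (100 * size L + 30) /\
    exists B : nat -> seq 'I_d,
    [/\ forall k, linked (arrs s' aNxt) (arrs s' aBkt k) (B k) /\ uniq (B k),
        forall k c, (c \in B k) = (c \in L) && (arrs s aRes c == k),
        forall c : 'I_d, c \notin L -> arrs s' aNxt c = arrs s aNxt c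
      & regs s' rS = 0 \/ exists2 c, c \in L & arrs s aRes c = regs s' rS]
    /\ forall c, c \in L -> arrs s aRes c <= regs s' rS) s n.
Proof.
move=> sV lL L_uniq sB sR hn.
have fst_d : arrs s aFst v <= d by apply: linked_le lL.
wps; rewrite ?sV; [lia | lia | lia | lia |].
pose I s' n' := exists D K, [/\ L = catrev D K, n + 100 * size K <= n' + 100 * size L + 20,
  linked (arrs s' aNxt) (regs s' rC) K,
  forall k, linked (arrs s' aNxt) (arrs s' aBkt k) [seq c : 'I_d <- D | arrs s aRes c == k]
  & [/\ forall c : 'I_d, c \notin L -> arrs s' aNxt c = arrs s aNxt c,
     forall c, c \in D -> arrs s aRes c <= regs s' rS
   & regs s' rS = 0 \/ exists2 c, c \in D & arrs s aRes c = regs s' rS]].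
apply: (@wp_while _ I).
  exists [::], L; split=> //=; [arith | by split=> //; left].
move=> s' n' [/= fr fa] [D [K [LE hn' lK lD [sN sS sS']]]].
have L_mem c : (c \in L) = (c \in D) || (c \in K).
  by rewrite LE catrevE mem_cat mem_rev.
split=> /= [|c0|c0]; first by arith.
  have K0 : K = [::] by case: (K) lK => // c K' []; rewrite c0.
  have D_mem c : (c \in D) = (c \in L) by rewrite L_mem K0 orbF.
  have D_uniq : uniq D by move: L_uniq; rewrite LE K0 catrevE cats0 rev_uniq.
  split; first by arith.
  exists (fun k => [seq c : 'I_d <- D | arrs s aRes c == k]); split; last first.
    by move=> c; rewrite -D_mem; apply: sS.
  split=> // [k|k c|]; first by rewrite filter_uniq.
    by rewrite mem_filter D_mem andbC.
  by case: sS' => [->|[c cD e]]; [left | right; exists c; rewrite -?D_mem].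
case: K LE hn' lK L_mem => [|a K] LE hn' lK L_mem; first by rewrite lK in c0.
case: lK => sC lK; have aL : a \in L by rewrite L_mem mem_head orbT.
have sRa : arrs s' aRes a = arrs s aRes a by rewrite fa.
have sRd := sR a aL; have a_d := ltn_ord a.
have next_d : arrs s' aNxt a <= d by apply: linked_le lK.
have bkt_d k : arrs s' aBkt k <= d.
  exact: linked_le (lD k).
have D_uniq : uniq (catrev D (a :: K)) by rewrite -LE.
have aDK : (a \notin D) && (a \notin K).
  move: D_uniq; rewrite catrevE cat_uniq /= mem_rev negb_or.
  by case/and3P => _ /andP[-> _] /andP[-> _].
case/andP: aDK => aD aK; rewrite /= in hn'.
wps; rewrite ?sC ?subSS ?subn0 ?sRa; try arith; try by have := bkt_d (arrs s aRes a); lia.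
set s1 := (X in wp _ _ _ X _).
have s1N (c : 'I_d) : c != a -> arrs s1 aNxt c = arrs s' aNxt c.
  by rewrite /= val_eqE => /negbTE ->.
have l1K : linked (arrs s1 aNxt) (arrs s' aNxt a) K.
  by apply: linked_eq lK => c cK; apply: s1N; apply: contraNneq aK => <-.
have l1D k : linked (arrs s1 aNxt) (arrs s1 aBkt k) [seq c : 'I_d <- a :: D | arrs s aRes c == k].
  have frD : linked (arrs s1 aNxt) (arrs s' aBkt k) [seq c : 'I_d <- D | arrs s aRes c == k].
    apply: linked_eq (lD k) => c; rewrite mem_filter => /andP[_ cD].
    by apply: s1N; apply: contraNneq aD => <-.
  rewrite /= [arrs s aRes a == k]eq_sym; case: (eqVneq k (arrs s aRes a)) => [e|_] //.
  by rewrite e in frD *; split=> //; rewrite [X in linked _ X]/upd eqxx.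
have s1N' (c : 'I_d) : c \notin L -> arrs s1 aNxt c = arrs s aNxt c.
  by move=> cL; rewrite s1N ?sN //; apply: contraNneq cL => ->.
have s1K : regs s1 rK = arrs s aRes a by [].
have s1S : regs s1 rS = regs s' rS by [].
have s1U : regs s1 rU = arrs s' aNxt a by [].
clearbody s1.
apply: wp_if => /=; rewrite ?s1K ?s1S; first by arith.
  move=> gt; wps; rewrite ?s1K ?s1U; try arith.
  exists (a :: D), K; split=> //=; rewrite ?s1U //; try arith.
  split=> // [c|]; rewrite ?s1K; last by right; exists a; rewrite ?mem_head.
  by rewrite inE => /predU1P[->|/sS] //; lia.
move=> le; wps; rewrite ?s1U; try arith.
exists (a :: D), K; split=> //=; rewrite ?s1U //; try arith.
split=> // [c|]; rewrite s1S.
  by rewrite inE => /predU1P[->|/sS] //; lia.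
case: sS' => [->|[c cD e]]; [by left | right; exists c => //].
by rewrite inE cD orbT.
Qed.

Variable l : nat.
Hypothesis l_d : 0 < l <= d.

(** Buckets are visited in decreasing order, so the residual of the last child cut
    serves as the threshold [t]; when nothing is cut, the largest residual does. *)
Lemma cut_wp s n (L : seq 'I_d) (B : nat -> seq 'I_d) :
  regs s rL = l -> regs s rR <= w ->
  (forall k, linked (arrs s aNxt) (arrs s aBkt k) (B k) /\ uniq (B k)) ->
  (forall k c, (c \in B k) = (c \in L) && (arrs s aRes c == k)) ->
  (forall c, c \in L -> [/\ 0 < arrs s aRes c <= l, arrs s aRes c <= regs s rS
     & arrs s aOut c = 0]) ->
  regs s rS <= d -> 100 * (regs s rS + size L) + 20 <= n ->
  wp w cut_prog (fun s' n' => n <= n' + (100 * (regs s rS + size L) + 20) /\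
    [/\ forall k, arrs s' aBkt k = 0,
        forall c : 'I_d, c \notin L -> arrs s' aOut c = arrs s aOut c,
        regs s' rR + \sum_(c | (c \in L) && (arrs s' aOut c != 0)) arrs s aRes c
          = regs s rR
      & exists t, [/\ forall c, c \in L -> arrs s' aOut c != 0 -> t <= arrs s aRes c,
        forall c, c \in L -> arrs s' aOut c = 0 ->
          arrs s aRes c <= t /\ regs s' rR <= l
        & forall c, c \in L -> arrs s' aOut c != 0 -> l < t + regs s' rR]]) s n.
Proof.
move=> sL sRw lB B_mem hL sSd hn.
(* The elements still in buckets; each iteration lowers the sum of this number
   and the bucket number by one. *)
pose pend (B' : nat -> seq 'I_d) := #|[set c in L | c \in B' (arrs s aRes c)]|.
have pend_le B' : pend B' <= size L.
  apply: leq_trans (card_size L); apply/subset_leq_card/subsetP => c.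
  by rewrite inE => /andP[].
pose I s' n' := exists k B', [/\ regs s' rS = k, k <= regs s rS,
  n + 100 * (k + pend B') <= n' + 100 * (regs s rS + size L) + 10,
  [/\ forall j, linked (arrs s' aNxt) (arrs s' aBkt j) (B' j) /\ uniq (B' j),
      forall j c, c \in B' j -> [/\ c \in L, arrs s aRes c = j & arrs s' aOut c = 0]
    & forall j, k < j -> B' j = [::]]
  & [/\ regs s' rR <= w, forall c : 'I_d, c \notin L -> arrs s' aOut c = arrs s aOut c,
        regs s' rR + \sum_(c | (c \in L) && (arrs s' aOut c != 0)) arrs s aRes c
          = regs s rR
      & exists t, [/\ k <= t,
        forall c, c \in L -> arrs s' aOut c != 0 -> t <= arrs s aRes c,
        forall c, c \in L -> arrs s' aOut c = 0 -> c \notin B' (arrs s aRes c) ->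
          arrs s aRes c <= t /\ regs s' rR <= l
        & forall c, c \in L -> arrs s' aOut c != 0 -> l < t + regs s' rR]]].
apply: (@wp_while _ I).
  exists (regs s rS), B; split=> //; first by have := pend_le B; arith.
    split=> // [j c|j lt_j].
      by rewrite B_mem => /andP[cL /eqP <-]; have [_ _ ->] := hL c cL.
    case EB: (B j) => [//|c b].
    have : c \in B j by rewrite EB mem_head.
    by rewrite B_mem => /andP[/hL[_ le _] /eqP e]; arith.
  split=> //; first by rewrite big_pred0 ?addn0 // => c;
    apply/negP => /andP[/hL[_ _ ->]]; rewrite eqxx.
  exists (regs s rS); split=> // c cL; have [_ _ e] := hL c cL; rewrite ?e //.
  by rewrite B_mem cL eqxx.
move=> s' n' [/= fr fa] [k [B' [sS kS hn' [lB' B'_mem B'_nil] [sR' sO sE [t [kt t1 t2 t3]]]]]].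
rewrite sS; split=> [|k0|k0]; first by arith.
  have B'0 j : B' j = [::].
    case: j => [|j]; last by apply: B'_nil; rewrite k0.
    case EB: (B' 0) => [//|c b]; have /B'_mem[/hL[]] : c \in B' 0 by rewrite EB mem_head.
    by move=> /andP[pos _] _ _ e; rewrite e in pos.
  split; first by arith.
  split=> //; first by move=> j; have [] := lB' j; rewrite B'0.
  by exists t; split=> // c cL c0; apply: t2 => //; rewrite B'0.
have sB := proj1 (lB' k); have sB_d := linked_le sB.
wps; rewrite ?sS; try arith.
apply: wp_if => /=; first by arith.
  case EB: (B' k) sB => [|a b] /= sB; first by rewrite sB.
  move=> _; case: sB => sBk lb; rewrite sBk.
  have /B'_mem[aL ra a0] : a \in B' k by rewrite EB mem_head.
  have [/andP[_ rl] _ _] := hL a aL; rewrite ra in rl.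
  have b_d := linked_le lb; have a_d := ltn_ord a.
  have ab : a \notin b by have [_] := lB' k; rewrite EB => /andP[].
  pose B1 j := if j == k then b else B' j.
  have B1_sub j (c : 'I_d) : c \in B1 j -> c \in B' j /\ c != a.
    rewrite /B1; case: (eqVneq j k) => [->|jk] cj.
      by rewrite EB inE cj orbT; split=> //; apply: contraNneq ab => <-.
    split=> //; apply: contraNneq jk => e.
    by have [_ <- _] := B'_mem j c cj; rewrite e ra.
  have B1E (c : 'I_d) :
      (c \in B1 (arrs s aRes c)) = (c != a) && (c \in B' (arrs s aRes c)).
    rewrite /B1; case: (eqVneq (arrs s aRes c) k) => [->|ne].
      by rewrite EB inE; case: (eqVneq c a) => //= ->; apply: negbTE.
    by case: (eqVneq c a) => // e; rewrite e ra eqxx in ne.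
  have pend1 : pend B' = (pend B1).+1.
    rewrite /pend (cardsD1 a) inE aL ra EB mem_head add1n; congr _.+1.
    by apply: eq_card => c; rewrite !inE B1E andbCA.
  wps; rewrite ?sS ?sBk ?subSS ?subn0; try arith.
  set s1 := (X in wp _ _ _ X _).
  have s1B j : linked (arrs s1 aNxt) (arrs s1 aBkt j) (B1 j) /\ uniq (B1 j).
    rewrite /= /B1; case: (eqVneq j k) => [_|//]; split=> //.
    by have [_] := lB' k; rewrite EB => /andP[].
  have s1O (c : 'I_d) : arrs s1 aOut c = arrs s' aOut c by [].
  have s1C : regs s1 rC = a.+1 by [].
  have s1S : regs s1 rS = k by [].
  have s1R : regs s1 rR = regs s' rR by [].
  have s1L : regs s1 rL = l by rewrite /= fr.
  have B1_nil j : k < j -> B1 j = [::].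
    by move=> kj; rewrite /B1 gtn_eqF // B'_nil.
  clearbody s1.
  apply: wp_if => /=; rewrite ?s1R ?s1L; first by arith.
    move=> over; wps; rewrite ?s1C ?s1R ?s1S ?subSS ?subn0; try arith.
    set s2 := (X in I X _).
    have s2O (c : 'I_d) : arrs s2 aOut c = if c == a then 1 else arrs s' aOut c.
      by rewrite /= val_eqE s1O.
    have s2B j : linked (arrs s2 aNxt) (arrs s2 aBkt j) (B1 j) by have [] := s1B j.
    have s2R : regs s2 rR = regs s' rR - k by [].
    have s2S : regs s2 rS = k by [].
    clearbody s2.
    exists k, B1; split=> //; first by rewrite pend1 in hn'; arith.
      split=> // [j|j c cj]; first by have [] := s1B j.
      have [/B'_mem[cL rc c0] ca] := B1_sub j c cj; split=> //.
      by rewrite s2O (negbTE ca).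
    split; rewrite ?s2R; first by arith.
    - move=> c cL; rewrite s2O sO //; case: eqP cL => [->|//].
      by rewrite aL.
    - rewrite (bigD1 a) /=; last by rewrite aL s2O eqxx.
      rewrite ra -sE addnA subnK; last by arith.
      congr (_ + _); apply: eq_bigl => c; rewrite s2O.
      by case: (eqVneq c a) => [->|_]; rewrite ?a0 ?eqxx ?andbF ?andbT.
    exists k; split=> // c cL; rewrite s2O.
    - case: (eqVneq c a) => [->|_ /(t1 c cL)]; first by rewrite ra.
      exact: leq_trans.
    - case: (eqVneq c a) => [//|ca] c0; rewrite B1E ca /= => cB.
      by have [_] := t2 c cL c0 cB; arith.
    - by arith.
  move=> under; wps; try arith.
  set s2 := (X in I X _).
  exists k, B1; split=> //; first by rewrite pend1 in hn'; arith.
    split=> // j c cj.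
    by have [/B'_mem[cL rc c0] ca] := B1_sub j c cj; rewrite s1O.
  split; rewrite ?s1R //.
  - by move=> c cL; rewrite s1O sO.
  - by rewrite -sE; congr (_ + _); apply: eq_bigl => c; rewrite s1O.
  exists t; split=> // c cL; rewrite s1O; [exact: t1 | | exact: t3].
  move=> c0; rewrite B1E; case: (eqVneq c a) => [->|_] /= cB; last exact: t2.
  by rewrite ra; split=> //; arith.
move=> sB0; rewrite sB0 in sB.
have Bk : B' k = [::] by case: (B' k) sB => // c b [].
wps; rewrite ?sS; try arith.
exists (k - 1), B'; split=> //=; rewrite ?sS //; try arith.
  split=> // j kj; case: (eqVneq j k) => [->//|jk]; apply: B'_nil; lia.
split=> //; exists t; split=> //; arith.
Qed.

End Buckets.

(** * The bottom-up pass *)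

Section Greedy.
Variables (d : nat) (x : 'I_d) (p : 'I_d -> 'I_d) (h : 'I_d -> nat).
Hypothesis h_p : forall v, v != x -> h (p v) < h v.
Variables (F : {set 'I_d}) (l : nat).
Hypothesis xF : x \in F.
Hypothesis l_d : 0 < l <= d.
Hypothesis F_feasible :
  forall f, f \in F -> #|[set v | nearest p h F v == f]| <= l.
Variable w : nat.
Hypothesis w_big : d + d < w.

Definition sensor_parent (v : 'I_d) : 'I_d := nearest p h F (p v).
Local Notation q := sensor_parent.
Local Notation qchild := (child x q).

Lemma qchildE u c : qchild u c = (c != x) && (u == q c).
Proof. by rewrite /child [q c == u]eq_sym. Qed.

Lemma sensor_parent_F v : q v \in F.
Proof. exact: (nearest_in h_p). Qed.

Lemma h_sensor_parent v : v != x -> h (q v) < h v.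
Proof. by move=> /h_p; apply: leq_ltn_trans; apply: (h_nearest h_p). Qed.

(** Cutting every candidate child always suffices, as what remains is a region
    of [F] itself. *)
Lemma forced_le v : 1 + #|[set c | qchild v c & c \notin F]| <= l.
Proof.
case: (boolP (v \in F)) => vF; last first.
  rewrite (_ : [set c | _ & _] = set0) ?cards0 //; first by case/andP: l_d.
  apply/setP => c; rewrite !inE /child; case: (eqVneq (q c) v) => [e|]; last by rewrite andbF.
  by rewrite -e sensor_parent_F in vF.
apply: leq_trans (F_feasible vF).
set S := [set c | _]; have vS : v \notin S by rewrite inE vF andbF.
have -> : 1 + #|S| = #|v |: S| by rewrite cardsU1 vS.
apply/subset_leq_card/subsetP => c; rewrite !inE.
case/predU1P=> [->|/andP[/andP[_ /eqP <-] cF]]; first by rewrite (nearest_id h_p).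
by rewrite (nearestE h_p) // (negbTE cF).
Qed.

(** The credits required beforehand refer to an arbitrary candidate child, and
    those consumed to the children actually cut: the sort costs the largest
    residual, and either the child attaining it is cut or a child with the same
    residual is. *)
Lemma overflow_wp s n (v : 'I_d) (L : seq 'I_d) :
  regs s rL = l -> regs s rV = v ->
  regs s rR = 1 + \sum_(c : 'I_d | qchild v c) arrs s aRes c -> regs s rR <= w ->
  linked (arrs s aNxt) (arrs s aFst v) L -> uniq L ->
  (forall c, (c \in L) = qchild v c && (c \in F)) ->
  (forall c, qchild v c -> [/\ 0 < arrs s aRes c <= l, arrs s aOut c = 0
     & c \notin F -> arrs s aRes c = 1]) ->
  (forall k, arrs s aBkt k = 0) -> 100 <= n ->
  (forall c, c \in L -> 200 * (#|[set c | qchild v c]| + arrs s aRes c) + 100 <= n) ->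
  wp w overflow_prog (fun s' n' => [/\
    n <= n' + 200 * (#|[set c | qchild v c]| +
      \sum_(c : 'I_d | qchild v c && (arrs s' aOut c != 0)) arrs s aRes c) + 100,
    regs s' rR + \sum_(c : 'I_d | qchild v c && (arrs s' aOut c != 0)) arrs s aRes c
      = regs s rR,
    regs s' rR <= l /\ exists t,
      [/\ forall c, qchild v c -> arrs s' aOut c != 0 -> t <= arrs s aRes c,
      forall c, qchild v c -> c \in F -> arrs s' aOut c = 0 -> arrs s aRes c <= t
      & forall c, qchild v c -> arrs s' aOut c != 0 -> l < t + regs s' rR]
    & [/\ forall c : 'I_d, ~~ (qchild v c && (c \in F)) -> arrs s' aOut c = arrs s aOut c,
        forall c : 'I_d, ~~ qchild v c -> arrs s' aNxt c = arrs s aNxt c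
      & forall k, arrs s' aBkt k = 0]]) s n.
Proof.
move=> sL sV sR sRw lL L_uniq L_mem hc sB n100 hn.
set K := #|_| in hn *.
have L_child c : c \in L -> qchild v c by rewrite L_mem => /andP[].
apply: wp_if => [|over|under]; rewrite /= ?sR ?sL; first by arith.
  (* The children outside F are leaves of residual 1, so some candidate exists
   when the piece is too large. *)
have rest : \sum_(c : 'I_d | qchild v c && (c \notin F)) arrs s aRes c < l.
    apply: leq_trans (forced_le v); rewrite add1n ltnS -sum1_card.
    rewrite [leqRHS](eq_bigl (fun c => qchild v c && (c \notin F))); last by move=> c; rewrite inE.
    by apply: leq_sum => c /andP[/hc[_ _ e] /e ->].
  have sumL (P : pred 'I_d) : \sum_(c : 'I_d | (c \in L) && P c) arrs s aRes c =
      \sum_(c : 'I_d | qchild v c && (c \in F) && P c) arrs s aRes c.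
    by apply: eq_bigl => c; rewrite L_mem.
  have L_nil : L <> [::].
    move=> L0; move: over; rewrite /= sR sL (bigID (mem F)) /=.
    rewrite big_pred0 => [|c]; last by rewrite -L_mem L0.
    by case; apply/eqP; rewrite subn_eq0 add0n add1n.
  have size_L : size L <= K.
    rewrite -(card_uniqP L_uniq); apply/subset_leq_card/subsetP => c /L_child.
    by rewrite inE.
  have hn1 : 200 * size L + 100 <= n.
    have [c cL] : exists c, c \in L.
      by case: (L) L_nil => // c L' _; exists c; rewrite mem_head.
    have size_pos : 0 < size L by case: (L) L_nil.
    by have := hn c cL; arith.
  have res_d c : c \in L -> arrs s aRes c <= d.
    by move=> /L_child/hc[/andP[_ le] _ _]; case/andP: l_d; lia.
  apply: wp_seq; apply: wp_framed; apply: (wp_mono _ (bucket_wp w_big sV lL L_uniq sB res_d _));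
    last by arith.
  move=> s1 n1 [hn' [B [[lB B_mem sN sS] sS']]] [/= fr fa].
  have s1R : regs s1 rR = regs s rR by rewrite fr.
  have s1Res (c : nat) : arrs s1 aRes c = arrs s aRes c by rewrite fa.
  have s1Out (c : nat) : arrs s1 aOut c = arrs s aOut c by rewrite fa.
  have sSd : regs s1 rS <= d by case: sS => [->|[c /res_d ? <-]].
  have hn2 : 100 * (regs s1 rS + size L) + 20 <= n1.
    case: sS => [->|[c cL <-]]; first by arith.
    by have := hn c cL; arith.
  have s1L : regs s1 rL = l by rewrite fr.
  have s1Rw : regs s1 rR <= w by rewrite s1R.
  have B_mem1 k c : (c \in B k) = (c \in L) && (arrs s1 aRes c == k).
    by rewrite B_mem s1Res.
  have cL1 c : c \in L -> [/\ 0 < arrs s1 aRes c <= l, arrs s1 aRes c <= regs s1 rS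
      & arrs s1 aOut c = 0].
    by move=> cL; rewrite s1Res s1Out; have [? -> _] := hc c (L_child c cL); split=> //; apply: sS'.
  have HH := cut_wp w_big l_d s1L s1Rw lB B_mem1 cL1 sSd hn2.
  apply: wp_framed; apply: (wp_mono _ HH) => s2 n2 [hn3 [s2B s2O s2R [t [t1 t2 t3]]]] [/= fr2 fa2].
    have cutE : \sum_(c : 'I_d | qchild v c && (arrs s2 aOut c != 0)) arrs s aRes c =
        \sum_(c : 'I_d | (c \in L) && (arrs s2 aOut c != 0)) arrs s1 aRes c.
      apply: eq_big => [c|c _]; last by rewrite s1Res.
      rewrite L_mem; case: (boolP (c \in F)) => cF; first by rewrite andbT.
      rewrite andbF; apply/negbTE/nandP; case: (boolP (qchild v c)); last by left.
      move=> cv; right; rewrite s2O ?L_mem ?(negbTE cF) ?andbF // s1Out.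
      by have [_ -> _] := hc c cv.
    have le_l : regs s2 rR <= l.
      case: (boolP [exists c : 'I_d, (c \in L) && (arrs s2 aOut c == 0)]).
        by case/existsP => c /andP[cL /eqP c0]; have [] := t2 c cL c0.
      move=> /existsPn none.
      have eL : \sum_(c : 'I_d | qchild v c && (c \in F)) arrs s aRes c =
          \sum_(c : 'I_d | qchild v c && (arrs s2 aOut c != 0)) arrs s aRes c.
        rewrite cutE; apply: eq_big => [c|c _]; last by rewrite s1Res.
        rewrite -L_mem; case: (boolP (c \in L)) => //= cL.
        by have := none c; rewrite cL.
      have := s2R; rewrite -cutE s1R sR -eL [X in _ = _ + X](bigID (mem F)) /=.
      have gen a b r : r + a = 1 + (a + b) -> b < l -> r <= l by lia.
      by move/gen; apply.
    split; rewrite ?cutE.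
    - have : regs s1 rS <= \sum_(c : 'I_d | (c \in L) && (arrs s2 aOut c != 0)) arrs s1 aRes c.
        have le_sum c : c \in L -> arrs s2 aOut c != 0 -> arrs s1 aRes c <=
            \sum_(c : 'I_d | (c \in L) && (arrs s2 aOut c != 0)) arrs s1 aRes c.
          by move=> cL c1; rewrite (bigD1 c) ?cL //= leq_addr.
        case: sS => [->//|[m mL <-]]; rewrite -s1Res.
        case: (eqVneq (arrs s2 aOut m) 0) => m0; last exact: le_sum.
        case: (boolP [exists c : 'I_d, (c \in L) && (arrs s2 aOut c != 0)]).
          case/existsP => c /andP[cL c1]; apply: leq_trans (le_sum c cL c1).
          by apply: leq_trans (t1 c cL c1); have [] := t2 m mL m0.
        move=> /existsPn none; move: s2R over; rewrite /= sL -s1R big_pred0; last first.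
          by move=> c; apply/negbTE/none.
        by arith.
      move: (\sum_(c : 'I_d | (c \in L) && (arrs s2 aOut c != 0)) arrs s1 aRes c) => S.
      by arith.
    - by rewrite s2R s1R sR.
    - split=> //; exists t; split=> c cv.
      + move=> c1; rewrite -s1Res; apply: t1 => //; rewrite L_mem cv /=.
        apply: contraNT c1 => cF; rewrite s2O ?L_mem ?(negbTE cF) ?andbF // s1Out.
        by have [_ -> _] := hc c cv.
      + by move=> cF c0; rewrite -s1Res; have [] := t2 c; rewrite ?L_mem ?cv.
      move=> c1; apply: (t3 c) => //; rewrite L_mem cv /=.
      apply: contraNT c1 => cF; rewrite s2O ?L_mem ?(negbTE cF) ?andbF // s1Out.
      by have [_ -> _] := hc c cv.
    split=> // c cv; first by rewrite s2O ?L_mem // s1Out.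
    by rewrite fa2 // sN // L_mem (negbTE cv).
have none c : qchild v c -> (arrs s aOut c != 0) = false by move=> /hc[_ -> _].
have cut0 : \sum_(c : 'I_d | qchild v c && (arrs s aOut c != 0)) arrs s aRes c = 0.
  by rewrite big_pred0 // => c; case: (boolP (qchild v c)) => //= /none ->.
rewrite /= sL in under; apply: wp_skip; first by arith.
rewrite cut0; split=> //; try arith.
split; first by arith.
exists l; split=> c cv; rewrite ?none //.
by move=> _ _; have [/andP[]] := hc c cv.
Qed.

Lemma attach_wp s n (v : 'I_d) (r : nat) : regs s rV = v -> regs s rR = r ->
  arrs s aPar v = (if v == x then 0 else (p v).+1) ->
  arrs s aF v = (v \in F) -> arrs s aAnc (p v) = q v ->
  (v != x -> arrs s aSum (q v) + r <= w /\ arrs s aFst (q v) <= d) -> 60 <= n ->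
  wp w attach_prog (fun s' n' => [/\ n <= n' + 60,
    forall u : 'I_d, arrs s' aSum u = arrs s aSum u + ((v != x) && (u == q v)) * r,
    forall u : 'I_d, arrs s' aNxt u =
      if [&& v != x, v \in F & u == v] then arrs s aFst (q v) else arrs s aNxt u,
    forall u : 'I_d, arrs s' aFst u =
      if [&& v != x, v \in F & u == q v] then v.+1 else arrs s aFst u
    & forall u : 'I_d, arrs s' aOut u = if (v == x) && (u == v) then 1 else arrs s aOut u]) s n.
Proof.
move=> sV sR sP sF sA bounds hn.
have v_d := ltn_ord v; have qv_d := ltn_ord (q v).
apply: wp_if => /=; rewrite ?sV ?sP; first by arith.
  case: (eqVneq v x) => //= vx _; have [sSw sFd] := bounds vx.
  wps; rewrite ?sV ?sP ?(negbTE vx) ?subn1 /= ?sA ?sR; try arith.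
  apply: wp_if => /=; rewrite ?sV ?sF ?sP ?(negbTE vx) ?subn1 /= ?sA; first by arith.
    case: (boolP (v \in F)) => // vF _; wps; rewrite ?sV ?sP ?(negbTE vx) ?subn1 /= ?sA; try arith.
    split=> [|u|u|u|u] //=; rewrite ?val_eqE //; first by arith.
    - by case: eqP => [->|_]; rewrite ?mul1n ?addn0.
    by case: eqP => // _; rewrite addn1.
  case: (boolP (v \in F)) => // vF _; wps; try arith.
  split=> [|u|u|u|u] //=; rewrite ?val_eqE //; first by arith.
  by case: eqP => [->|_]; rewrite ?mul1n ?addn0.
case: (eqVneq v x) => //= vx _; wps; rewrite ?sV; try arith.
split=> [|u|u|u|u] //=; rewrite ?val_eqE ?addn0 //; arith.
Qed.

Section Order.
Variable o : seq 'I_d.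
Hypothesis o_leaf : leaf_order x p o.

Let o_mem v : v \in o.
Proof. by case: o_leaf => o_uniq o_d _; apply: mem_full. Qed.

Lemma index_lt_d v : index v o < d.
Proof. by have := index_mem v o; case: o_leaf => _ -> _; rewrite o_mem. Qed.

(** Leaves-first for [p] implies leaves-first for the contracted tree, since the
    nearest vertex of [F] above is an ancestor. *)
Lemma index_sensor_parent v : v != x -> index v o < index (q v) o.
Proof.
have up u : index u o <= index (nearest p h F u) o.
  elim/(root_ind h_p): u => u IH; rewrite (nearestE h_p) //.
  case: ifP => // /negbT uF; have ux : u != x by apply: contraNneq uF => ->.
  apply: leq_trans (IH ux); apply: ltnW; case: o_leaf => _ _; apply.
  by rewrite in_kids ux eqxx.
move=> vx; apply: leq_trans (up (p v)); case: o_leaf => _ _; apply.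
by rewrite in_kids vx eqxx.
Qed.

Definition processed (i : nat) : {set 'I_d} := [set v | index v o < i].

(** The lists of candidate children matter only at unprocessed vertices, as
    processing a vertex consumes its list.  A chosen vertex other than the root
    is chosen when its parent in the contracted tree is processed. *)
Definition greedy_inv (i : nat) (s : state) : Prop :=
  let P := processed i in let J := output d s in
  let r := fun v : 'I_d => arrs s aRes v in
  [/\ forall u : 'I_d, arrs s aSum u = \sum_(c | qchild u c && (c \in P)) r c,
      forall u : 'I_d, u \notin P -> exists L,
        [/\ linked (arrs s aNxt) (arrs s aFst u) L, uniq L
          & forall c, (c \in L) = [&& qchild u c, c \in P & c \in F]],
      forall v, v \in P -> residual x q J r v /\ greedy_at x q F J r l v,
      forall k, arrs s aBkt k = 0
    & [/\ J \subset F, forall c, c \in J -> c \in P /\ (c != x -> q c \in P)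
        & x \in P -> x \in J]].

(** The amortized cost of the sorts so far: each processed vertex is charged its
    children and the sizes of the pieces cut from it. *)
Definition spent (i : nat) (s : state) : nat :=
  \sum_(u in processed i) (#|[set c | qchild u c]| +
    \sum_(c | qchild u c && (arrs s aOut c != 0)) arrs s aRes c).

Lemma in_output s (c : 'I_d) : (c \in output d s) = (arrs s aOut c != 0).
Proof. by rewrite inE. Qed.

Lemma processed_child i u c : u \in processed i -> qchild u c -> c \in processed i.
Proof.
rewrite !inE => ui /andP[cx /eqP cu]; apply: ltn_trans ui; rewrite -cu.
exact: index_sensor_parent.
Qed.

(** Children of distinct vertices are distinct, and pieces that have been cut are
    disjoint from each other and from the pieces [X] still hanging at [u]. *)
Lemma spent_le i s (X : {set 'I_d}) u : greedy_inv i s -> u \notin processed i ->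
  (forall c, c \in X -> qchild u c && (c \in processed i)) ->
  spent i s + (#|[set c | qchild u c]| + \sum_(c in X) arrs s aRes c) <= d + d.
Proof.
case=> _ _ done _ _ uP XP; rewrite /spent big_split /= addnACA; apply: leq_add.
  have := sum_card_children x q; rewrite card_ord; apply: leq_trans.
  rewrite [leqRHS](bigID (mem (processed i))) /= leq_add2l.
  by rewrite (bigD1 u) //= leq_addr.
apply: leq_trans (_ : #|processed i| <= _); last by rewrite -[leqRHS]card_ord max_card.
rewrite (eq_bigr (fun v => \sum_(c | qchild v c && (c \in output d s)) arrs s aRes c)).
  apply: (@sum_cut_residuals _ x q) => [v /done[]//|c cx qc|c /XP/andP[/andP[_ /eqP ->] ->]].
    by apply: processed_child qc _; rewrite /child cx eqxx.
  by [].
by move=> v _; apply: eq_bigl => c; rewrite in_output.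
Qed.

Lemma spent_bound i s : greedy_inv i s -> spent i s <= d + d.
Proof.
move=> inv; have [all_in|[u uP]] : processed i = setT \/ exists u, u \notin processed i.
  case: (boolP [forall u, u \in processed i]) => [/forallP all_in|/forallPn[u uP]].
    by left; apply/setP => u; rewrite all_in inE.
  by right; exists u.
  case: inv => _ _ done _ _; rewrite /spent big_split /=; apply: leq_add.
    have := sum_card_children x q; rewrite card_ord; apply: leq_trans.
    by rewrite [leqRHS](bigID (mem (processed i))) /= leq_addr.
  have := @sum_cut_residuals _ x q (output d s) (fun c => arrs s aRes c) setT set0.
  rewrite big_set0 addn0 cardsT card_ord all_in => le.
  apply: leq_trans (le _ _ _) => [|v vP|c _ _|c]; rewrite ?inE //.
    by apply: eq_leq; apply: eq_bigr => v _; apply: eq_bigl => c; rewrite in_output.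
  by have [] := done v; rewrite ?all_in.
have := spent_le inv uP (X := set0); rewrite big_set0 => le.
by apply: leq_trans (le _); [rewrite leq_addr | move=> c; rewrite inE].
Qed.

(** One iteration, from state [s] to [s'], processes the vertex [v] at position [i]:
    [rho] is its residual and [cut] the choice after its children have been cut. *)
Section Step.
Variables (i : nat) (s s' : state) (rho : nat) (cut : pred 'I_d).
Hypothesis i_d : i < d.
Let v := nth x o i.
Hypothesis inv : greedy_inv i s.
Let r (c : 'I_d) := arrs s aRes c.
Hypothesis out' : forall c, (c \in output d s') = (v == x) && (c == v) || cut c.
Hypothesis cut_old : forall c, ~~ (qchild v c && (c \in F)) -> cut c = (c \in output d s).
Hypothesis res' : forall c : 'I_d, arrs s' aRes c = if c == v then rho else r c.
Hypothesis sum' : forall u : 'I_d,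
  arrs s' aSum u = arrs s aSum u + ((v != x) && (u == q v)) * rho.
Hypothesis nxt' : forall c : 'I_d, ~~ qchild v c -> arrs s' aNxt c =
  if [&& v != x, v \in F & c == v] then arrs s aFst (q v) else arrs s aNxt c.
Hypothesis fst' : forall u : 'I_d, arrs s' aFst u =
  if [&& v != x, v \in F & u == q v] then v.+1 else arrs s aFst u.
Hypothesis bkt' : forall k, arrs s' aBkt k = 0.
Hypothesis rhoE : rho + \sum_(c | qchild v c && cut c) r c = 1 + \sum_(c | qchild v c) r c.
Hypothesis rho_l : rho <= l.
Hypothesis cut_top : exists t, [/\ forall c, qchild v c -> cut c -> t <= r c,
  forall c, qchild v c -> c \in F -> ~~ cut c -> r c <= t
  & forall c, qchild v c -> cut c -> l < t + rho].

Let iv : index v o = i.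
Proof. by case: o_leaf => o_uniq o_d _; rewrite index_uniq ?o_d. Qed.

Let vP : v \notin processed i.
Proof. by rewrite inE iv ltnn. Qed.

Let processedS c : (c \in processed i.+1) = (c == v) || (c \in processed i).
Proof.
rewrite !inE ltnS leq_eqVlt -iv; congr (_ || _); apply/eqP/eqP => [e|-> //].
by rewrite -(nth_index x (o_mem c)) e nth_index.
Qed.

Let child_P c : qchild v c -> c \in processed i.
Proof.
by case/andP => cx /eqP e; rewrite inE -iv -e index_sensor_parent.
Qed.

Let old_neq c : c \in processed i -> c != v.
Proof. by apply: contraTneq => ->. Qed.

Lemma child_old u c : u \in processed i -> qchild u c ->
  [/\ c \in processed i, arrs s' aRes c = r c
    & (c \in output d s') = (c \in output d s)].
Proof.
move=> uP uc; have cP := processed_child uP uc; have cv := old_neq cP.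
rewrite res' out' (negbTE cv) andbF /= cut_old //.
apply: contra vP => /andP[/andP[_ /eqP <-] _].
by case/andP: uc => _ /eqP->.
Qed.

Lemma done_step u : u \in processed i.+1 ->
  residual x q (output d s') (fun c => arrs s' aRes c) u /\
  greedy_at x q F (output d s') (fun c => arrs s' aRes c) l u.
Proof.
rewrite processedS => /predU1P[->|uP].
  have new c : qchild v c -> (arrs s' aRes c = r c) * ((c \in output d s') = cut c).
    by move=> /child_P/old_neq cv; rewrite res' out' (negbTE cv) andbF.
  have resv : arrs s' aRes v = rho by rewrite res' eqxx.
  split; last first.
    split; first by rewrite resv.
    have [t [t1 t2 t3]] := cut_top; exists t; split=> c vc.
    - by rewrite !new //; apply: t1.
    - by move=> cF; rewrite !new //; apply: t2.
    - by rewrite resv new //; apply: t3.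
  rewrite /residual resv; move: rhoE; rewrite [in RHS](bigID cut) /=.
  have -> : \sum_(c | qchild v c && (c \notin output d s')) arrs s' aRes c =
            \sum_(c | qchild v c && ~~ cut c) r c.
    apply: eq_big => [c|c /andP[/new[-> _]]//].
    by case: (boolP (qchild v c)) => //= /new[_ ->].
  have gen a b t : t + a = 1 + (a + b) -> t = 1 + b by lia.
  exact: gen.
have uv := old_neq uP; case: inv => _ _ /(_ u uP) [resu [le [t [t1 t2 t3]]]] _ _.
have same c : qchild u c -> (arrs s' aRes c = r c) *
    ((c \in output d s') = (c \in output d s)).
  by move=> uc; have [_ -> ->] := child_old uP uc.
have resu' : arrs s' aRes u = r u by rewrite res' (negbTE uv).
split.
  rewrite /residual resu' /r resu; congr (_ + _); apply: eq_big => [c|c].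
    by case: (boolP (qchild u c)) => //= /same[_ ->].
  by case/andP => /same[-> _].
split; first by rewrite resu'.
exists t; split=> c uc.
- by rewrite !same //; apply: t1.
- by rewrite !same //; apply: t2.
- by rewrite resu' same //; apply: t3.
Qed.

Lemma sum_step (u : 'I_d) : arrs s' aSum u =
  \sum_(c | qchild u c && (c \in processed i.+1)) arrs s' aRes c.
Proof.
rewrite sum'; case: inv => -> _ _ _ _; rewrite [RHS](bigID (pred1 v)) /= addnC.
congr (_ + _); last first.
  apply: eq_big => [c|c /andP[_ /old_neq cv]]; last by rewrite res' (negbTE cv).
  rewrite processedS; case: (eqVneq c v) => [->|_]; last by rewrite andbT.
  by rewrite (negbTE vP) !andbF.
case: (boolP (qchild u v)) => uv.
  rewrite (big_pred1 v) => [|c]; last first.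
    by rewrite /= processedS; case: eqP => [->|_]; rewrite ?uv ?andbF.
  by move: uv; rewrite res' eqxx qchildE => ->; rewrite mul1n.
rewrite big_pred0 => [|c]; last first.
  by case: (eqVneq c v) => [->|_]; rewrite ?(negbTE uv) ?andbF.
by move: uv; rewrite qchildE => /negbTE->.
Qed.

Lemma list_step (u : 'I_d) : u \notin processed i.+1 -> exists L,
  [/\ linked (arrs s' aNxt) (arrs s' aFst u) L, uniq L
    & forall c, (c \in L) = [&& qchild u c, c \in processed i.+1 & c \in F]].
Proof.
rewrite processedS negb_or => /andP[uv uP].
case: inv => _ /(_ u uP) [L [lL L_uniq L_mem]] _ _ _.
have L_nxt (c : 'I_d) : c \in L -> arrs s' aNxt c = arrs s aNxt c.
  rewrite L_mem => /and3P[/andP[_ /eqP cu] cP _]; have cv := old_neq cP.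
  by rewrite nxt' ?(negbTE cv) ?andbF // /child cu (negbTE uv) andbF.
have lL' : linked (arrs s' aNxt) (arrs s aFst u) L by apply: linked_eq lL.
have vL : v \notin L by rewrite L_mem (negbTE vP) andbF.
case: (boolP [&& v != x, v \in F & u == q v]) => [/and3P[vx vF /eqP uqv]|no].
  exists (v :: L); split.
  - rewrite /= fst' vx vF uqv eqxx; split=> //.
    rewrite nxt' ?vx ?vF ?eqxx -?uqv // /child -uqv (negbTE uv) andbF //.
  - by rewrite /= vL.
  move=> c; rewrite inE L_mem processedS; case: (eqVneq c v) => [->|//].
  by rewrite /child vx vF uqv eqxx.
exists L; split=> //; first by rewrite fst' (negbTE no).
move=> c; rewrite L_mem processedS; case: (eqVneq c v) => [->|//].
rewrite (negbTE vP) andbF; apply/esym/negbTE; apply: contra no.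
by rewrite qchildE => /and3P[/andP[-> ->] _ ->].
Qed.

Lemma greedy_step : greedy_inv i.+1 s'.
Proof.
split; [exact: sum_step | exact: list_step | exact: done_step | exact: bkt' |].
case: inv => _ _ _ _ [JF JP xJ]; split.
- apply/subsetP => c; rewrite out' => /orP[/andP[/eqP vx /eqP ->]|cc]; first by rewrite vx.
  case: (boolP (qchild v c && (c \in F))) => [/andP[]//|old].
  by apply: (subsetP JF); rewrite -cut_old.
- move=> c; rewrite out' !processedS => /orP[/andP[/eqP vx /eqP ->]|cc].
    by rewrite eqxx; split=> // /eqP.
  case: (boolP (qchild v c && (c \in F))) => [/andP[vc cF]|old].
    by rewrite (child_P vc) orbT; case/andP: vc => _ ->.
  have /JP[-> H] : c \in output d s by rewrite -cut_old.
  by rewrite orbT; split=> // /H ->; rewrite orbT.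
rewrite processedS out' => /predU1P[<-|xP]; first by rewrite !eqxx.
rewrite [cut x]cut_old ?xJ ?orbT //.
by rewrite /child eqxx.
Qed.

Lemma spent_step : spent i.+1 s' = spent i s + (#|[set c | qchild v c]| +
  \sum_(c | qchild v c && cut c) r c).
Proof.
rewrite /spent (bigD1 v) /=; last by rewrite processedS eqxx.
rewrite addnC; congr (_ + (_ + _)).
  apply: eq_big => [u|u]; rewrite processedS.
    by case: (eqVneq u v) => [->|_]; rewrite ?(negbTE vP) ?andbT.
  case/andP => /predU1P[->|uP _]; first by rewrite eqxx.
  congr (_ + _); apply: eq_big => [c|c].
    case: (boolP (qchild u c)) => //= uc.
    by have [_ _] := child_old uP uc; rewrite !in_output.
  by case/andP => uc _; have [_ ->] := child_old uP uc.
apply: eq_big => [c|c].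
  case: (boolP (qchild v c)) => //= /child_P/old_neq cv.
  by rewrite -in_output out' (negbTE cv) andbF.
by case/andP => /child_P/old_neq cv _; rewrite res' (negbTE cv).
Qed.

End Step.

(** The credits left plus a constant multiple of [i] and of [spent] never drop
    below the initial credits. *)
Lemma greedy_wp s n : regs s rD = d -> regs s rL = l -> parents_in x p s ->
  (forall v : 'I_d, arrs s aF v = (v \in F)) -> queue_in s o ->
  anc_from p h F o 0 s ->
  (forall a k, a \in [:: aOut; aSum; aFst; aNxt; aRes; aBkt] -> arrs s a k = 0) ->
  1000 * d + 200 <= n ->
  wp w greedy_prog (fun s' n' => greedy_inv d s') s n.
Proof.
move=> sD sL sP sF sQ sA s0 hn; have l_le : l <= d by case/andP: l_d.
wps; [arith | arith |].
pose I s' n' := exists i, [/\ regs s' rI = i, i <= d, greedy_inv i s'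
  & n <= n' + 400 * i + 200 * spent i s' + 10].
have P0 : processed 0 = set0 by apply/setP => c; rewrite !inE.
apply: (@wp_while _ I).
  exists 0; split=> //=; last by rewrite /spent P0 big_set0; arith.
  split=> [u|u _|v|k|]; rewrite /= ?P0 ?s0 ?inE //.
  - by rewrite big_pred0 // => c; rewrite inE andbF.
  - exists [::]; split=> //=.
    by move=> c; rewrite inE andbF.
  have J0 : output d (State (upd (regs s) rI 0) (arrs s)) = set0.
    by apply/setP => c; rewrite !inE /= s0.
  by split=> [|c|]; rewrite ?J0 ?sub0set // inE.
move=> s' n' [/= fr fa] [i [sI i_le inv hn']]; have sp := spent_bound inv.
rewrite /= sI fr //= sD; split=> [|i_m|i_m]; first by arith.
  by have <- : i = d by lia.
have {i_m}i_d : i < d by lia.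
have [o_uniq o_d _] := o_leaf.
have i_o : i < size o by rewrite o_d.
pose v := nth x o i.
have iv : index v o = i by rewrite index_uniq.
have vP : v \notin processed i by rewrite inE iv ltnn.
have sOi : arrs s' aOrd i = v by rewrite fa // sQ.2 // (nth_map x).
have [sumE lists done bkt0 [JF JP xJ]] := inv.
have [L [lL L_uniq L_mem']] := lists v vP.
have child_P c : qchild v c -> c \in processed i.
  by case/andP => cx /eqP e; rewrite inE -iv -e index_sensor_parent.
have L_mem c : (c \in L) = qchild v c && (c \in F).
  by rewrite L_mem'; case: (boolP (qchild v c)) => //= /child_P ->.
have sum_d (u : 'I_d) : u \notin processed i -> arrs s' aSum u <= d.
  move=> uP; rewrite sumE.
  have := @sum_cut_residuals _ x q (output d s') (fun c => arrs s' aRes c) (processed i)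
    [set c | qchild u c && (c \in processed i)].
  have -> : \sum_(c in [set c | qchild u c && (c \in processed i)]) arrs s' aRes c =
      \sum_(c | qchild u c && (c \in processed i)) arrs s' aRes c.
    by apply: eq_bigl => c; rewrite inE.
  move=> le; apply: leq_trans (leq_trans (leq_addl _ _) (le _ _ _)) _.
  - by move=> c /done[].
  - by move=> c cx qc; apply: processed_child qc _; rewrite /child cx eqxx.
  - by move=> c; rewrite in_set => /andP[/andP[_ /eqP ->] ->].
  by rewrite -[leqRHS]card_ord max_card.
have v_d := ltn_ord v; have sumv := sum_d v vP.
wps; rewrite ?sI ?sOi; try arith.
set s1 := (X in wp _ _ _ X _).
have s1A a : arrs s1 a = arrs s' a by [].
have s1V : regs s1 rV = v by [].
have s1R : regs s1 rR = arrs s' aSum v + 1 by [].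
have s1L : regs s1 rL = l by rewrite /= fr.
have s1I : regs s1 rI = i by [].
have s1D : regs s1 rD = d by rewrite /= fr.
clearbody s1.
have child_ok c : qchild v c -> [/\ 0 < arrs s1 aRes c <= l, arrs s1 aOut c = 0
     & c \notin F -> arrs s1 aRes c = 1].
  move=> vc; have cP := child_P c vc; have [res [le _]] := done c cP.
  rewrite !s1A; split; first by rewrite le andbT res.
    apply/eqP; rewrite -[_ == 0]negbK -in_output; apply/negP => /JP[_ H].
    by case/andP: vc => /H + /eqP e; rewrite e (negbTE vP).
  move=> cF; rewrite res big_pred0 // => b; apply/negP => /andP[/andP[_ /eqP e] _].
  by rewrite -e sensor_parent_F in cF.
have sum1 : regs s1 rR = 1 + \sum_(c : 'I_d | qchild v c) arrs s1 aRes c.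
  rewrite s1R sumE addnC; congr (_ + _); apply: eq_big => [c|c _]; last by rewrite s1A.
  by case: (boolP (qchild v c)) => //= /child_P ->.
apply: wp_framed.
have s1Rw : regs s1 rR <= w by rewrite s1R; arith.
have lL1 : linked (arrs s1 aNxt) (arrs s1 aFst v) L by rewrite !s1A.
have bkt1 k : arrs s1 aBkt k = 0 by rewrite s1A.
have le_spent c : c \in L ->
    spent i s' + (#|[set c | qchild v c]| + arrs s1 aRes c) <= d + d.
  move=> cL; have := @spent_le i s' [set c] v inv vP; rewrite big_set1 s1A; apply.
  by move=> b; rewrite in_set1 => /eqP ->; move: cL; rewrite L_mem' => /and3P[-> ->].
apply: (wp_mono _ (overflow_wp s1L s1V sum1 s1Rw lL1 L_uniq L_mem child_ok bkt1 _ _)).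
- move=> s2 n2 [hn2 rhoE [rho_l top] [s2O s2N s2B]] [/= fr2 fa2].
set rho := regs s2 rR in rhoE rho_l top.
have cut_spent : spent i s' + (#|[set c | qchild v c]| +
    \sum_(c : 'I_d | qchild v c && (arrs s2 aOut c != 0)) arrs s1 aRes c) <= d + d.
  rewrite s1A.
  have := @spent_le i s' [set c | qchild v c && (arrs s2 aOut c != 0)] v inv vP.
  rewrite (eq_bigl (fun c => qchild v c && (arrs s2 aOut c != 0))).
    by apply=> c; rewrite in_set => /andP[vc _]; rewrite vc child_P.
  by move=> c; rewrite in_set.
set S := \sum_(c | _) _ in cut_spent hn2.
have s2V : regs s2 rV = v by rewrite fr2.
have s2I : regs s2 rI = i by rewrite fr2.
wps; rewrite ?s2V; try arith.
set s3 := (X in wp _ _ _ X _).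
have s3A a : a != aRes -> arrs s3 a = arrs s2 a by rewrite /= => /negbTE ->.
have s3Res (c : 'I_d) : arrs s3 aRes c = if c == v then rho else arrs s' aRes c.
  by rewrite /= val_eqE fa2 // s1A.
have s3V : regs s3 rV = v by [].
have s3I : regs s3 rI = i by [].
have s3R : regs s3 rR = rho by [].
clearbody s3.
have qv_d := ltn_ord (q v).
have s3P : arrs s3 aPar v = if v == x then 0 else (p v).+1.
  by rewrite s3A // fa2 // s1A fa // sP.
have s3F : arrs s3 aF v = (v \in F) by rewrite s3A // fa2 // s1A fa // sF.
have s3Anc : arrs s3 aAnc (p v) = q v by rewrite s3A // fa2 // s1A fa // sA.
apply: wp_framed.
have qv_new : v != x -> q v \notin processed i.
  by move=> vx; rewrite inE -leqNgt -iv ltnW // index_sensor_parent.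
have bounds : v != x -> arrs s3 aSum (q v) + rho <= w /\ arrs s3 aFst (q v) <= d.
  move=> vx; rewrite !s3A // !fa2 // !s1A; split.
    by have := sum_d (q v) (qv_new vx); clear -rho_l w_big l_le; lia.
  by have [L' [lL' _ _]] := lists (q v) (qv_new vx); apply: linked_le lL'.
apply: (wp_mono _ (attach_wp s3V s3R s3P s3F s3Anc bounds _));
  last by clear -hn hn' hn2 cut_spent i_d; lia.
move=> s4 n4 [hn4 s4S s4N s4F s4O] [/= fr4 fa4].
wps; rewrite ?fr4 ?s3I //; try by clear -hn hn' hn2 hn4 cut_spent i_d w_big; lia.
set s5 := (X in I X _).
have s5A a : arrs s5 a = arrs s4 a by [].
have s5I : regs s5 rI = i.+1 by rewrite /= addn1.
clearbody s5.
have out5 c : (c \in output d s5) = (v == x) && (c == v) || (arrs s2 aOut c != 0).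
  by rewrite in_output s5A s4O s3A //; case: (_ && _).
have cut_old c : ~~ (qchild v c && (c \in F)) ->
    (arrs s2 aOut c != 0) = (c \in output d s').
  by move=> old; rewrite in_output s2O // s1A.
have res5 (c : 'I_d) : arrs s5 aRes c = if c == v then rho else arrs s' aRes c.
  by rewrite s5A fa4 // s3Res.
have rhoE' : rho + \sum_(c : 'I_d | qchild v c && (arrs s2 aOut c != 0)) arrs s' aRes c =
    1 + \sum_(c : 'I_d | qchild v c) arrs s' aRes c.
  by move: rhoE; rewrite sum1 !s1A.
exists i.+1; split=> //.
  apply: (greedy_step (cut := fun c => arrs s2 aOut c != 0)) i_d inv out5 cut_old res5
    _ _ _ _ rhoE' rho_l _.
  - by move=> u; rewrite s5A s4S s3A // fa2 // s1A.
  - by move=> c vc; rewrite s5A s4N !s3A // s2N // fa2 // !s1A.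
  - by move=> u; rewrite s5A s4F !s3A // fa2 // s1A.
  - by move=> k; rewrite s5A fa4 // s3A.
  have [t [t1 t2 t3]] := top; exists t; split=> c vc.
  - by move=> /(t1 c vc); rewrite s1A.
  - by move=> cF c0; have := t2 c vc cF; rewrite s1A; apply; apply/eqP; rewrite -[_ == 0]negbK.
  - exact: t3.
have -> : spent i.+1 s5 = spent i s' + (#|[set c | qchild v c]| + S).
  by rewrite /S s1A; apply: spent_step i_d out5 cut_old res5.
by clear -hn' hn2 hn4 hn; lia.
- by arith.
by move=> c /le_spent; arith.
Qed.

End Order.
End Greedy.

(** * Assembly *)

Lemma sensor_prog_wp (d : nat) (x : 'I_d) (p : 'I_d -> 'I_d) (h : 'I_d -> nat)
    (F : {set 'I_d}) (l w : nat) (es : seq ('I_d * 'I_d)) :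
  (forall v, v != x -> h (p v) < h v) -> x \in F -> 0 < l <= d ->
  (forall f, f \in F -> #|[set v | nearest p h F v == f]| <= l) ->
  uniq es -> (forall u v, ((u, v) \in es) = (v == u) || ((u != x) && (v == p u))) ->
  d + d < w ->
  wp w sensor_prog (fun s' _ => exists o, leaf_order x p o /\
    greedy_inv x p h F l o d s') (input es F l) (2000 * d).
Proof.
move=> h_p xF l_d F_l es_uniq es_mem w_big; set s := input es F l.
have d_pos : 0 < d by case/andP: l_d; apply: leq_trans.
have s0 a k : 2 < a -> arrs s a k = 0.
  by case: a => [|[|[|a]]] //= _; rewrite !nth_nil.
have sF (v : 'I_d) : arrs s aF v = (v \in F).
  by rewrite /= (nth_map x) ?nth_ord_enum // size_enum_ord.
have sT k : arrs s aTail k = nth 0 [seq val e.1 | e <- es] k by [].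
have sH k : arrs s aHead k = nth 0 [seq val e.2 | e <- es] k by [].
have [sD sL sM] : [/\ regs s rD = d, regs s rL = l & regs s rM = size es] by [].
clearbody s; apply: wp_seq; apply: wp_framed.
have sPar k : arrs s aPar k = 0 by apply: s0.
apply: (wp_mono _ (parents_wp h_p w_big es_uniq es_mem sM sT sH sPar _)); last by lia.
move=> s1 n1 [s1P hn1] [/= fr1 fa1]; apply: wp_seq; apply: wp_framed.
have s1D : regs s1 rD = d by rewrite fr1.
have s1Deg k : arrs s1 aDeg k = 0 by rewrite fa1 // s0.
apply: (wp_mono _ (degrees_wp w_big s1D s1P s1Deg _)); last by lia.
move=> s2 n2 [s2Deg hn2] [/= fr2 fa2]; apply: wp_seq; apply: wp_framed.
have s2D : regs s2 rD = d by rewrite fr2.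
apply: (wp_mono _ (leaves_wp w_big s2D s2Deg _)); last by lia.
move=> s3 n3 [[o0 [sQ0 o0_uniq o0_mem]] hn3] [/= fr3 fa3]; apply: wp_seq; apply: wp_framed.
have s3D : regs s3 rD = d by rewrite fr3.
have s3P : parents_in x p s3 by move=> v; rewrite fa3 // fa2 // s1P.
have s3Deg (v : 'I_d) : arrs s3 aDeg v = #|kids x p v| by rewrite fa3 // s2Deg.
apply: (wp_mono _ (queue_wp h_p w_big s3D s3P s3Deg sQ0 o0_uniq o0_mem _)); last by lia.
move=> s4 n4 [[o [sQ o_leaf]] hn4] [/= fr4 fa4]; apply: wp_seq; apply: wp_framed.
have s4D : regs s4 rD = d by rewrite fr4.
have s4P : parents_in x p s4 by move=> v; rewrite fa4 // s3P.
have s4F (v : 'I_d) : arrs s4 aF v = (v \in F).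
  by rewrite fa4 // fa3 // fa2 // fa1 // sF.
apply: (wp_mono _ (ancestors_wp h_p w_big xF s4D s4P s4F sQ o_leaf _)); last by lia.
move=> s5 n5 [sA hn5] [/= fr5 fa5].
have s5D : regs s5 rD = d by rewrite fr5.
have s5L : regs s5 rL = l by rewrite fr5 // fr4 // fr3 // fr2 // fr1.
have s5P : parents_in x p s5 by move=> v; rewrite fa5 // s4P.
have s5F (v : 'I_d) : arrs s5 aF v = (v \in F) by rewrite fa5.
have s5Q : queue_in s5 o by split; rewrite ?fr5 ?fa5 //; case: sQ.
have s50 a k : a \in [:: aOut; aSum; aFst; aNxt; aRes; aBkt] -> arrs s5 a k = 0.
  move=> a_new; have a2 : 2 < a by move: a_new; rewrite !inE; lia.
  by rewrite fa5 ?fa4 ?fa3 ?fa2 ?fa1 ?s0 //; move: a_new; rewrite !inE; lia.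
apply: (wp_mono _ (greedy_wp h_p xF l_d F_l w_big o_leaf s5D s5L s5P s5F s5Q sA s50 _)); last by lia.
by move=> s6 n6 inv; exists o.
Qed.

(** The regions of the output have the residuals as sizes; any feasible
    competitor has residuals at most [l] in the contracted tree as well, so
    [greedy_card] compares the two. *)
Lemma greedy_optimal (R : realType) (d : nat) (A : 'M[bool]_d) (x : 'I_d)
    (p : 'I_d -> 'I_d) (h : 'I_d -> nat) (F : {set 'I_d}) (l : nat)
    (o : seq 'I_d) (s : state) :
  (forall v, v != x -> h (p v) < h v) ->
  (forall u v, A v u = (v == u) || ((u != x) && (v == p u))) ->
  0 < l <= d -> x \in F -> leaf_order x p o -> greedy_inv x p h F l o d s ->
  optimal_solution R A F l (output d s).
Proof.
move=> h_p A_p l_d xF o_leaf [_ _ done _ [JF _ xJ]].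
set J := output d s in done JF xJ *.
pose q := sensor_parent p h F; pose r := fun v : 'I_d => arrs s aRes v.
have all_in v : v \in processed o d by rewrite inE (index_lt_d o_leaf).
have {}xJ := xJ (all_in x).
have h_q : forall v, v != x -> h (q v) < h v := h_sensor_parent h_p xF.
have near_q (K : {set 'I_d}) : x \in K -> K \subset F -> forall v,
    nearest p h K v = if v \in K then v else nearest p h K (q v).
  by move=> xK KF v; rewrite (nearest_sub h_p) // (nearestE h_p).
have resE v : residual x q J r v by have [] := done v (all_in v).
have grE v : greedy_at x q F J r l v by have [] := done v (all_in v).
split=> //.
  apply/(feasibleP R h_p A_p J l_d); split=> // j jJ.
  rewrite -(residual_size xJ (near_q J xJ JF) resE jJ).
  by have [] := grE j.
move=> J' J'F /(feasibleP R h_p A_p J' l_d)[xJ' J'l].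
have [r' r'E] := leaf_rec h_q (fun=> 1) (fun c => c \notin J').
apply: (greedy_card h_q (sensor_parent_F h_p xF) xJ xJ' J'F resE grE r'E).
exact: (residual_bounded h_q xJ' (near_q J' xJ' J'F) r'E J'l).
Qed.

Local Open Scope ring_scope.

Theorem mainTheorem5 (R : realType) :
  exists (alg : prog) (c : nat),
    forall (d : nat) (A : 'M[bool]_d) (F : {set 'I_d}) (l : nat)
           (es : seq ('I_d * 'I_d)),
      (exists x : 'I_d, self_looped_tree_towards (digraph A) x) ->
      (1 <= l <= d)%N ->
      (obs_index R A (sensor_mx F) <= l%:R%:E)%E ->
      edge_list (digraph A) es ->
      exists (s : state) (t : nat),
        [/\ exec (c * d) alg (input es F l) s t,
            (t <= c * d)%N
          & optimal_solution R A F l (output d s)].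
Proof.
(* The loops take at most 1320 d + 350 time units in total. *)
exists sensor_prog, 2000%N => d A F l es [x /tree_parent[p [h [h_p A_p]]]] l_d.
case/(feasibleP R h_p A_p F l_d) => xF F_l [es_uniq es_mem].
have es_p u v : ((u, v) \in es) = (v == u) || ((u != x) && (v == p u)).
  by rewrite es_mem -A_p.
have w_big : (d + d < 2000 * d)%N by case/andP: l_d; lia.
have [s [t [run le [o [o_leaf inv]]]]] :=
  sensor_prog_wp h_p xF l_d F_l es_uniq es_p w_big.
exists s, t; split=> //; exact: greedy_optimal h_p A_p l_d xF o_leaf inv.
Qed.
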